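(* For every integer $n\ge 3$ the $(n+6)$-point quadrature formula $$Q_{n+6}[f]=-\frac{5}{48n}\sigma(0)+\frac{15}{16n}\sigma\Big(\frac1{6n}\Big)-\frac{21}{16n}\sigma\Big(\frac1{3n}\Big)+\frac{71}{48n}\sigma\Big(\frac1{2n}\Big)+\frac1n\sum_{k=2}^{n-1}f\Big(\frac{2k-1}{2n}\Big),\qquad \sigma(x):=f(x)+f(1-x),$$ is positive definite of order $4$, with error constant $$c_4(Q_{n+6})=\frac{1}{720\,n^4}\Big(1-\frac{125}{144\,n}\Big),$$ and the sequence $\{Q_{n+6}\}$ is asymptotically optimal positive definite of order $4$, i.e. $\lim_{n\to\infty}c_4(Q_{n+6})/c^{+}_{n+6,4}=1$.
   Context: An $N$-point quadrature formula is a functional $Q[f]=\sum_{i=1}^{N}a_i f(\tau_i)$ with nodes $0\le\tau_1<\dots<\tau_N\le 1$ and real weights; its remainder is $R[Q;f]=\int_0^1 f(x)\,dx-Q[f]$. $Q$ is positive definite of order $4$, with error constant $c_4(Q)$, if there is a constant $c_4(Q)>0$ such that for every $f\in C^4[0,1]$ there is $\xi\in[0,1]$ with $R[Q;f]=c_4(Q)f^{(4)}(\xi)$. $c^{+}_{N,4}$ denotes the infimum of $c_4(Q)$ over all $N$-point positive definite quadrature formulae $Q$ of order $4$. *)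

(* Defs.v *)
From Stdlib Require Import Reals Lra Lia.
From Coquelicot Require Import Coquelicot.
Open Scope R_scope.

Definition I01 (x : R) : Prop := 0 <= x <= 1.

(* f restricted to [0,1] is of class C^r, and d k is its k-th derivative there
   for every k <= r.  [D_in] and [continue_in] are relative to [0,1], so the
   derivatives at 0 and 1 are one-sided; values outside [0,1] are irrelevant. *)
Definition is_Cr_with_derivatives (r : nat) (f : R -> R) (d : nat -> R -> R)
  : Prop :=
  (forall x, I01 x -> d O x = f x) /\
  (forall k x, (k < r)%nat -> I01 x -> D_in (d k) (d (S k)) I01 x) /\
  (forall x, I01 x -> continue_in (d r) I01 x).

(* Nodes and weights are indexed by 1, ..., N. *)
Definition is_quadrature (N : nat) (Q : (R -> R) -> R) : Prop :=
  exists a tau : nat -> R,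
    (forall i, (1 <= i <= N)%nat -> 0 <= tau i <= 1) /\
    (forall i, (1 <= i < N)%nat -> tau i < tau (S i)) /\
    (forall f, Q f = sum_n_m (fun i => a i * f (tau i)) 1 N).

Definition remainder (Q : (R -> R) -> R) (f : R -> R) : R := RInt f 0 1 - Q f.

Definition is_error_constant (r : nat) (Q : (R -> R) -> R) (c : R) : Prop :=
  0 < c /\
  forall (f : R -> R) (d : nat -> R -> R), is_Cr_with_derivatives r f d ->
    exists xi, 0 <= xi <= 1 /\ remainder Q f = c * d r xi.

Definition positive_definite (r : nat) (Q : (R -> R) -> R) : Prop :=
  exists c, is_error_constant r Q c.

(* Meaningful when Q is positive definite: the constant is then unique, see
   [is_error_constant_unique] for r = 4. *)
Definition error_constant (r : nat) (Q : (R -> R) -> R) : R :=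
  iota (is_error_constant r Q).

(* The set is bounded below by 0, so its infimum is finite as soon as some
   N-point positive definite formula of order r exists. *)
Definition c_plus (N r : nat) : R :=
  real (Glb_Rbar (fun c => exists Q,
    is_quadrature N Q /\ positive_definite r Q /\ c = error_constant r Q)).

Definition sigma (f : R -> R) (x : R) : R := f x + f (1 - x).

Definition Qn6 (n : nat) (f : R -> R) : R :=
  - (5 / (48 * INR n)) * sigma f 0
  + 15 / (16 * INR n) * sigma f (1 / (6 * INR n))
  - 21 / (16 * INR n) * sigma f (1 / (3 * INR n))
  + 71 / (48 * INR n) * sigma f (1 / (2 * INR n))
  + 1 / INR n *
    sum_n_m (fun k => f ((2 * INR k - 1) / (2 * INR n))) 2 (n - 1).

Lemma is_error_constant_unique (Q : (R -> R) -> R) (c1 c2 : R) :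
  is_error_constant 4 Q c1 -> is_error_constant 4 Q c2 -> c1 = c2.
Proof.
intros [_ H1] [_ H2].
pose (d := fun k : nat => match k with
  | O => fun x : R => x ^ 4
  | 1%nat => fun x => 4 * x ^ 3
  | 2%nat => fun x => 12 * x ^ 2
  | 3%nat => fun x => 24 * x
  | _ => fun _ => 24 end).
assert (Hd : is_Cr_with_derivatives 4 (fun x => x ^ 4) d).
{ split; [reflexivity | split].
  - intros k x Hk _.
    apply (D_in_imp _ _ no_cond); [intros; exact I |].
    apply derivable_pt_lim_D_in, is_derive_Reals.
    destruct k as [|[|[|[|k]]]]; [| | | | lia];
      unfold d; auto_derive; trivial; ring.
  - intros x _. apply (cont_deriv _ (fun _ => 0)). apply Dconst. }
destruct (H1 _ d Hd) as [x1 [_ E1]].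
destruct (H2 _ d Hd) as [x2 [_ E2]].
unfold d in E1, E2; lra.
Qed.

Lemma error_constant_eq (Q : (R -> R) -> R) (c : R) :
  is_error_constant 4 Q c -> error_constant 4 Q = c.
Proof.
intros H.
apply (@iota_unique R_AbsRing R_CompleteNormedModule (is_error_constant 4 Q) c);
  [| exact H].
intros y Hy; exact (is_error_constant_unique Q y c Hy H).
Qed.

(* Main.v *)
Require Import Defs.
From Stdlib Require Import Reals.
From Coquelicot Require Import Coquelicot.
From Stdlib Require Import Lra Lia Psatz Wf_nat List Permutation Sorted Classical ClassicalEpsilon.
Open Scope R_scope.

(* The error constant of [Qn6] comes from its Peano kernel, which on each cell between
   consecutive nodes is an explicit nonnegative quartic.

   For the lower bound let [Q] be a positive definite formula with [N] nodes, and let [l] be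
   the linear spline with second derivative [sum_i a_i delta_(tau_i)], so that
   [x^2/2 - l] is the second derivative of the Peano kernel of [Q].  If all weights are
   nonnegative, then [l] is convex, and testing [Q] against its own Peano kernel gives
   [c_4(Q) >= int (x^2/2 - l)^2], which is at least [1 / (720 (N+1)^4)] because [l] has at most
   [N+1] linear pieces.  In general [l] is replaced by its best approximation in the mean by a
   convex spline [c] with [N+5] kinks.  The twofold primitive [D] of [l - c] then vanishes
   doubly at the kinks of [c], and a Rolle count shows that not all [N+5] kinks can be in use.
   As a spare kink could be inserted anywhere, optimality yields [D <= 0], which is what
   the previous argument needs in place of convexity of [l]. *)

(** The norm of the best approximation is the mean-square norm plus the squared slope beyond the
    last kink, that is, the squared mass of the second derivative. Kinks near 1 are almost invisible
    in the mean on [0,1]; without the extra term nothing would bound their weights, and a minimizer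
    need not exist. With it, the second derivatives of splines form a Gram space with kernel [ker],
    D becomes the potential of a signed measure, and optimality is a statement about potentials.

    How D <= 0 is used: let nu be the second derivative of c, and U the potential of Lebesgue
    measure minus that of nu. As U'''' = 1 - nu with nu >= 0 and the Peano kernel is nonnegative,
    the remainder of Q at U is at most c_4(Q). Passing from Q to nu in this remainder adds int D -
    nu(D); here nu(D) = 0 because D vanishes at the kinks in use, and int D <= 0. What is left is
    the squared norm of Lebesgue measure minus nu.

    On the side of the formula, the interior kernel is that of the trapezoidal rule with derivative
    corrections at the ends; the end weights let the kernel near 0 and 1 join it smoothly enough
    that these corrections cancel. *)

(** * Truncated powers *)

Definition ppart (x : R) : R := Rmax 0 x.

Lemma ppart_nonneg x : 0 <= ppart x.
Proof. apply Rmax_l. Qed.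

Lemma ppart_right x : 0 <= x -> ppart x = x.
Proof. intros H; apply Rmax_right; lra. Qed.

Lemma ppart_left x : x <= 0 -> ppart x = 0.
Proof. intros H; apply Rmax_left; lra. Qed.

Lemma ppart_lipschitz x y : Rabs (ppart x - ppart y) <= Rabs (x - y).
Proof.
unfold ppart, Rmax; repeat destruct Rle_dec; unfold Rabs; repeat destruct Rcase_abs; lra.
Qed.

Lemma continuous_ppart x : continuous ppart x.
Proof.
apply (continuity_pt_filterlim ppart x).
intros eps He; exists eps; split; [exact He|].
intros y [_ Hy]; simpl in *; unfold R_dist in *.
eapply Rle_lt_trans; [apply ppart_lipschitz | exact Hy].
Qed.

Lemma is_derive_ppart_pow n x :
  is_derive (fun t => ppart t ^ S (S n)) x (INR (S (S n)) * ppart x ^ S n).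
Proof.
destruct (total_order_T x 0) as [[Hx|Hx]|Hx].
- rewrite (ppart_left x) by lra.
  apply (is_derive_ext_loc (fun _ => 0)).
  + exists (mkposreal (- x) ltac:(lra)); intros y Hy.
    rewrite ppart_left; [simpl; ring|].
    change (Rabs (y - x) < - x) in Hy. apply Rabs_def2 in Hy; lra.
  + evar_last; [apply is_derive_const | simpl; unfold zero; simpl; ring].
- subst x; rewrite ppart_left by lra.
  replace (INR (S (S n)) * 0 ^ S n) with 0 by (simpl; ring).
  apply is_derive_Reals; intros eps He.
  exists (mkposreal (Rmin eps 1) (Rmin_pos _ _ He Rlt_0_1)); intros h Hh Hl; simpl in Hl.
  rewrite Rplus_0_l, (ppart_left 0) by lra.
  replace ((ppart h ^ S (S n) - 0 ^ S (S n)) / h - 0) with (ppart h ^ S (S n) / h)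
    by (simpl; field; exact Hh).
  destruct (Rle_dec h 0) as [H0|H0].
  + rewrite (ppart_left h) by exact H0.
    replace (0 ^ S (S n) / h) with 0 by (simpl; field; exact Hh).
    rewrite Rabs_R0; exact He.
  + rewrite (ppart_right h) by lra.
    replace (h ^ S (S n) / h) with (h ^ S n) by (simpl; field; exact Hh).
    rewrite (Rabs_pos_eq h) in Hl by lra.
    assert (H1 : h < eps) by (eapply Rlt_le_trans; [exact Hl | apply Rmin_l]).
    assert (H2 : h < 1) by (eapply Rlt_le_trans; [exact Hl | apply Rmin_r]).
    assert (H3 : 0 <= h ^ n <= 1).
    { split; [apply pow_le; lra|]. rewrite <- (pow1 n); apply pow_incr; lra. }
    rewrite Rabs_pos_eq; simpl; nra.
- rewrite (ppart_right x) by lra.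
  apply (is_derive_ext_loc (fun t => t ^ S (S n))).
  + exists (mkposreal x Hx); intros y Hy.
    change (Rabs (y - x) < x) in Hy. apply Rabs_def2 in Hy.
    rewrite ppart_right; [reflexivity | lra].
  + auto_derive; [exact I|]. rewrite Rmult_1_l. reflexivity.
Qed.

Lemma is_derive_ppart_shift n s x :
  is_derive (fun t => ppart (t - s) ^ S (S n)) x (INR (S (S n)) * ppart (x - s) ^ S n).
Proof.
evar_last.
- apply (is_derive_comp (fun t => ppart t ^ S (S n)) (fun t => t - s)).
  + apply is_derive_ppart_pow.
  + auto_derive; [exact I | reflexivity].
- unfold scal; simpl; unfold mult; simpl; ring.
Qed.

Lemma continuous_ppart_shift s x : continuous (fun t => ppart (t - s)) x.
Proof.
apply (continuous_comp (fun t => t - s) ppart).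
- apply (ex_derive_continuous (fun t => t - s)); auto_derive; exact I.
- apply continuous_ppart.
Qed.

(** * Finitely supported signed measures *)

(** A list of pairs (weight, position) serves both as a quadrature formula and as the second
    derivative of a linear spline. Repeated positions and zero weights are allowed, so that a
    minimization can run over lists of fixed length. *)
Fixpoint lin (mu : list (R * R)) (g : R -> R) : R :=
  match mu with
  | nil => 0
  | p :: l => fst p * g (snd p) + lin l g
  end.

Definition oppm (mu : list (R * R)) : list (R * R) :=
  map (fun p => (- fst p, snd p)) mu.

Definition mass (mu : list (R * R)) : R := lin mu (fun _ => 1).

Lemma lin_app l1 l2 g : lin (l1 ++ l2) g = lin l1 g + lin l2 g.
Proof. induction l1 as [|p l IH]; simpl; [|rewrite IH]; ring. Qed.

Lemma lin_oppm l g : lin (oppm l) g = - lin l g.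
Proof. induction l as [|p l IH]; simpl; [|rewrite IH]; ring. Qed.

Lemma lin_plus l g h : lin l (fun x => g x + h x) = lin l g + lin l h.
Proof. induction l as [|p l IH]; simpl; [|rewrite IH]; ring. Qed.

Lemma lin_scal l k g : lin l (fun x => k * g x) = k * lin l g.
Proof. induction l as [|p l IH]; simpl; [|rewrite IH]; ring. Qed.

Lemma lin_ext l g h : (forall p, In p l -> g (snd p) = h (snd p)) -> lin l g = lin l h.
Proof.
induction l as [|p l IH]; simpl; intros H; [reflexivity|].
rewrite (H p) by auto; rewrite IH; [reflexivity|]; intros q Hq; apply H; auto.
Qed.

Lemma lin_ext_all l g h : (forall x, g x = h x) -> lin l g = lin l h.
Proof. intros H; apply lin_ext; intros; apply H. Qed.

Lemma lin_swap l1 l2 (F : R -> R -> R) :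
  lin l1 (fun s => lin l2 (F s)) = lin l2 (fun t => lin l1 (fun s => F s t)).
Proof.
induction l1 as [|p l IH]; simpl.
- induction l2 as [|q l2 IH2]; simpl; [|rewrite <- IH2]; ring.
- rewrite IH, <- lin_scal, <- lin_plus; reflexivity.
Qed.

Lemma lin_Permutation l1 l2 g : Permutation l1 l2 -> lin l1 g = lin l2 g.
Proof. induction 1; simpl; lra. Qed.

Lemma lin_le l g h :
  (forall p, In p l -> 0 <= fst p) ->
  (forall p, In p l -> g (snd p) <= h (snd p)) -> lin l g <= lin l h.
Proof.
induction l as [|p l IH]; simpl; intros H0 H; [lra|].
assert (H1 := H0 p (or_introl eq_refl)); assert (H2 := H p (or_introl eq_refl)).
assert (lin l g <= lin l h) by (apply IH; auto).
nra.
Qed.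

Definition total_variation (mu : list (R * R)) : R :=
  fold_right (fun p s => Rabs (fst p) + s) 0 mu.

Lemma lin_abs_le l g B :
  (forall p, In p l -> Rabs (g (snd p)) <= B) -> Rabs (lin l g) <= total_variation l * B.
Proof.
induction l as [|p l IH]; simpl; intros H.
- rewrite Rabs_R0; lra.
- eapply Rle_trans; [apply Rabs_triang|].
  rewrite Rabs_mult.
  assert (H1 := H p (or_introl eq_refl)).
  assert (H2 : Rabs (lin l g) <= total_variation l * B) by auto.
  assert (H3 := Rabs_pos (fst p)).
  nra.
Qed.

Lemma total_variation_nonneg l : 0 <= total_variation l.
Proof.
induction l as [|p l IH]; simpl; [lra|].
assert (H := Rabs_pos (fst p)); lra.
Qed.

Lemma continuous_lin l (F : R -> R -> R) x :
  (forall s, continuous (F s) x) -> continuous (fun t => lin l (fun s => F s t)) x.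
Proof.
intros H; induction l as [|p l IH]; simpl.
- apply continuous_const.
- apply (continuous_plus (fun t => fst p * F (snd p) t)); [|exact IH].
  apply (continuous_scal_r (fst p) (F (snd p))); apply H.
Qed.

Lemma is_derive_lin l (F F' : R -> R -> R) x :
  (forall s, is_derive (F s) x (F' s x)) ->
  is_derive (fun t => lin l (fun s => F s t)) x (lin l (fun s => F' s x)).
Proof.
intros H; induction l as [|p l IH]; simpl.
- apply (is_derive_const 0).
- apply (is_derive_plus (fun t => fst p * F (snd p) t)); [|exact IH].
  apply (is_derive_scal (F (snd p))); apply H.
Qed.

Lemma ex_RInt_of_continuous (g : R -> R) a b :
  (forall x, continuous g x) -> ex_RInt g a b.
Proof. intros H; apply (@ex_RInt_continuous R_CompleteNormedModule g); intros; apply H. Qed.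

Lemma RInt_lin l (F : R -> R -> R) a b :
  (forall s x, continuous (F s) x) ->
  RInt (fun x => lin l (fun s => F s x)) a b = lin l (fun s => RInt (F s) a b).
Proof.
intros H; induction l as [|p l IH]; simpl.
- rewrite RInt_const; unfold scal; simpl; unfold mult; simpl; ring.
- rewrite (RInt_plus (fun x => fst p * F (snd p) x) (fun x => lin l (fun s => F s x))).
  + rewrite IH; unfold plus; simpl; f_equal.
    apply (RInt_scal (F (snd p)) a b (fst p)).
    apply ex_RInt_of_continuous; apply H.
  + apply ex_RInt_of_continuous; intros x; apply (continuous_scal_r (fst p) (F (snd p))), H.
  + apply ex_RInt_of_continuous; intros x; apply continuous_lin; intros; apply H.
Qed.

(** * The kernel and its potentials *)

(** By [ker_RInt] this is 1 plus the Gram kernel of the truncated linear functions on [0,1]. The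
    summand 1 makes the energy dominate the squared mass, see [energy_ge]; without it an atom at 1
    would have no energy. *)
Definition ker (s t : R) : R :=
  1 + ppart (t - s) ^ 3 / 6 - (1 - s) ^ 3 / 6 + (1 - t) * (1 - s) ^ 2 / 2.

Lemma ker_sym s t : ker s t = ker t s.
Proof.
unfold ker; destruct (Rle_dec s t) as [H|H].
- rewrite (ppart_right (t - s)), (ppart_left (s - t)) by lra; field.
- rewrite (ppart_left (t - s)), (ppart_right (s - t)) by lra; field.
Qed.

Lemma ker_diag s : ker s s = 1 + (1 - s) ^ 3 / 3.
Proof. unfold ker; rewrite ppart_left by lra; field. Qed.

Lemma RInt_of_derive (F f : R -> R) a b :
  (forall x, is_derive F x (f x)) -> (forall x, continuous f x) ->
  RInt f a b = F b - F a.
Proof.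
intros HF Hf; apply is_RInt_unique.
apply (is_RInt_derive F f); intros; auto.
Qed.

Lemma ker_RInt s t : 0 <= s <= 1 -> 0 <= t <= 1 ->
  ker s t = 1 + RInt (fun x => ppart (x - s) * ppart (x - t)) 0 1.
Proof.
assert (W : forall s t, 0 <= s -> t <= 1 -> s <= t ->
  ker s t = 1 + RInt (fun x => ppart (x - s) * ppart (x - t)) 0 1).
{ clear s t; intros s t Hs Ht Hst.
  (* The primitive comes from writing x - s = (x - t) + (t - s) where x >= t. *)
  rewrite (RInt_of_derive (fun x => ppart (x - t) ^ 3 / 3 + (t - s) * ppart (x - t) ^ 2 / 2)).
  - unfold ker; rewrite (ppart_right (t - s)), (ppart_right (1 - t)), (ppart_left (0 - t)) by lra.
    field.
  - intros x; evar_last.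
    + apply (is_derive_plus (fun x => ppart (x - t) ^ 3 / 3)
                            (fun x => (t - s) * ppart (x - t) ^ 2 / 2)).
      * apply (is_derive_ext (fun x => / 3 * ppart (x - t) ^ 3)); [intros; simpl; field|].
        apply (is_derive_scal (fun x => ppart (x - t) ^ 3)), (is_derive_ppart_shift 1).
      * apply (is_derive_ext (fun x => (t - s) / 2 * ppart (x - t) ^ 2)); [intros; simpl; field|].
        apply (is_derive_scal (fun x => ppart (x - t) ^ 2)), (is_derive_ppart_shift 0).
    + unfold plus; simpl. destruct (Rle_dec x t) as [H|H].
      * rewrite (ppart_left (x - t)) by lra; field.
      * rewrite (ppart_right (x - t)), (ppart_right (x - s)) by lra; field.
  - intros x; apply (continuous_mult (fun x => ppart (x - s))); apply continuous_ppart_shift. }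
intros Hs Ht; destruct (Rle_dec s t) as [H|H].
- apply W; lra.
- rewrite ker_sym, W by lra; f_equal.
  apply RInt_ext; intros; apply Rmult_comm.
Qed.

(** [ddpot] is the linear spline with second derivative [mu]. For [mu] supported in [0,1], [pot] is
    the twofold primitive of it whose value at 1 is the mass and whose derivative at 1 is 0. *)
Definition pot (mu : list (R * R)) (t : R) : R := lin mu (fun s => ker s t).
Definition dpot (mu : list (R * R)) (t : R) : R :=
  lin mu (fun s => ppart (t - s) ^ 2 / 2 - (1 - s) ^ 2 / 2).
Definition ddpot (mu : list (R * R)) (t : R) : R := lin mu (fun s => ppart (t - s)).

Lemma is_derive_ker s t :
  is_derive (ker s) t (ppart (t - s) ^ 2 / 2 - (1 - s) ^ 2 / 2).
Proof.
apply (is_derive_ext (fun t => / 6 * ppart (t - s) ^ 3 +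
  (1 - (1 - s) ^ 3 / 6 + (1 - t) * (1 - s) ^ 2 / 2))).
{ intros; unfold ker; simpl; field. }
evar_last.
- apply (is_derive_plus (fun t => / 6 * ppart (t - s) ^ 3)).
  + apply (is_derive_scal (fun x => ppart (x - s) ^ 3)), (is_derive_ppart_shift 1).
  + auto_derive; [exact I | reflexivity].
- unfold plus; simpl; field.
Qed.

Lemma is_derive_dker s t :
  is_derive (fun t => ppart (t - s) ^ 2 / 2 - (1 - s) ^ 2 / 2) t (ppart (t - s)).
Proof.
apply (is_derive_ext (fun t => / 2 * ppart (t - s) ^ 2 + - ((1 - s) ^ 2 / 2))).
{ intros; simpl; field. }
evar_last.
- apply (is_derive_plus (fun t => / 2 * ppart (t - s) ^ 2)).
  + apply (is_derive_scal (fun x => ppart (x - s) ^ 2)), (is_derive_ppart_shift 0).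
  + apply is_derive_const.
- unfold plus, zero; simpl; field.
Qed.

Lemma is_derive_pot mu t : is_derive (pot mu) t (dpot mu t).
Proof.
apply (is_derive_lin mu ker (fun s t => ppart (t - s) ^ 2 / 2 - (1 - s) ^ 2 / 2)).
intros s; apply is_derive_ker.
Qed.

Lemma is_derive_dpot mu t : is_derive (dpot mu) t (ddpot mu t).
Proof.
apply (is_derive_lin mu (fun s t => ppart (t - s) ^ 2 / 2 - (1 - s) ^ 2 / 2)
                        (fun s t => ppart (t - s))).
intros s; apply is_derive_dker.
Qed.

Lemma continuous_ddpot mu t : continuous (ddpot mu) t.
Proof. apply (continuous_lin mu (fun s t => ppart (t - s))); intros; apply continuous_ppart_shift. Qed.

Lemma continuous_pot mu t : continuous (pot mu) t.
Proof. apply (ex_derive_continuous (pot mu)); eexists; apply is_derive_pot. Qed.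

Lemma continuous_ker s t : continuous (ker s) t.
Proof. apply (ex_derive_continuous (ker s)); eexists; apply is_derive_ker. Qed.

Definition energy (mu : list (R * R)) : R := lin mu (pot mu).

Definition supported (mu : list (R * R)) : Prop :=
  forall p, In p mu -> 0 <= snd p <= 1.

Lemma RInt_ddpot mu (g : R -> R) : (forall x, continuous g x) ->
  RInt (fun x => ddpot mu x * g x) 0 1 =
  lin mu (fun s => RInt (fun x => ppart (x - s) * g x) 0 1).
Proof.
intros Hg.
rewrite <- (RInt_lin mu (fun s x => ppart (x - s) * g x)).
- apply RInt_ext; intros x _; unfold ddpot.
  rewrite Rmult_comm, <- lin_scal; apply lin_ext_all; intros; ring.
- intros s x; apply (continuous_mult (fun x => ppart (x - s)) g); [apply continuous_ppart_shift | apply Hg].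
Qed.

Lemma energy_eq mu : supported mu ->
  energy mu = mass mu ^ 2 + RInt (fun x => ddpot mu x * ddpot mu x) 0 1.
Proof.
intros Hs; unfold energy, mass.
rewrite RInt_ddpot by (intros; apply continuous_ddpot).
replace (lin mu (fun _ => 1) ^ 2) with (lin mu (fun _ => lin mu (fun _ => 1))).
- rewrite <- lin_plus; apply lin_ext; intros p Hp.
  unfold pot.
  rewrite (RInt_ext _ (fun x => ddpot mu x * ppart (x - snd p))) by (intros; apply Rmult_comm).
  rewrite RInt_ddpot by (intros; apply continuous_ppart_shift).
  rewrite <- lin_plus; apply lin_ext; intros q Hq.
  apply ker_RInt; auto.
- rewrite (lin_ext_all mu _ (fun _ => lin mu (fun _ => 1) * 1)) by (intros; ring).
  rewrite lin_scal; simpl; ring.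
Qed.

Lemma energy_ge mu : supported mu -> mass mu ^ 2 <= energy mu.
Proof.
intros Hs; rewrite energy_eq by exact Hs.
assert (0 <= RInt (fun x => ddpot mu x * ddpot mu x) 0 1); [|lra].
apply RInt_ge_0; [lra | |].
- apply ex_RInt_of_continuous; intros x.
  apply (continuous_mult (ddpot mu) (ddpot mu)); apply continuous_ddpot.
- intros; nra.
Qed.

(** * Minimization over measures with a bounded number of atoms *)

Lemma lipschitz_min (f : R -> R) a b L : a <= b ->
  (forall x y, a <= x <= b -> a <= y <= b -> Rabs (f x - f y) <= L * Rabs (x - y)) ->
  exists x, a <= x <= b /\ forall y, a <= y <= b -> f x <= f y.
Proof.
intros Hab HL.
(* The extreme value theorem asks for two-sided continuity at the end points as well, so [f] is made
   constant outside the interval. *)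
pose (c := fun x => Rmax a (Rmin b x)).
assert (Hc : forall x, a <= c x <= b).
{ intros x; unfold c, Rmax, Rmin; repeat destruct Rle_dec; lra. }
assert (Hid : forall x, a <= x <= b -> c x = x).
{ intros x Hx; unfold c, Rmax, Rmin; repeat destruct Rle_dec; lra. }
assert (Hlip : forall x y, Rabs (c x - c y) <= Rabs (x - y)).
{ intros x y; unfold c, Rmax, Rmin; repeat destruct Rle_dec;
  unfold Rabs; repeat destruct Rcase_abs; lra. }
destruct (continuity_ab_min (fun x => f (c x)) a b Hab) as [m [Hm1 Hm2]].
- intros x _ eps He.
  exists (eps / (Rabs L + 1)); split.
  { assert (H := Rabs_pos L); apply Rdiv_lt_0_compat; lra. }
  intros y [_ Hy]; simpl in *; unfold R_dist in *.
  assert (H := Rabs_pos L).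
  apply Rle_lt_trans with ((Rabs L + 1) * Rabs (y - x)).
  + eapply Rle_trans; [apply HL; apply Hc|].
    assert (H1 := Hlip y x); assert (H2 := Rle_abs L); assert (H3 := Rabs_pos (c y - c x)).
    nra.
  + apply (Rmult_lt_compat_l (Rabs L + 1)) in Hy; [|lra].
    replace eps with ((Rabs L + 1) * (eps / (Rabs L + 1))) by (field; lra).
    exact Hy.
- exists m; split; [exact Hm2|].
  intros y Hy; specialize (Hm1 y Hy); simpl in Hm1.
  rewrite !Hid in Hm1 by assumption; exact Hm1.
Qed.

Definition in_box (La : R) (p : R * R) : Prop := 0 <= fst p <= La /\ 0 <= snd p <= 1.

Definition dist1 (p q : R * R) : R := Rabs (fst p - fst q) + Rabs (snd p - snd q).

Lemma dist1_sym p q : dist1 p q = dist1 q p.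
Proof. unfold dist1; rewrite (Rabs_minus_sym (fst p)), (Rabs_minus_sym (snd p)); ring. Qed.

(** Minimize in the position first, for each fixed weight. The minimal value is again Lipschitz in
    the weight, since the best position for one weight is a competitor for any other. *)
Lemma box_min La (g : R * R -> R) L : 0 <= La ->
  (forall p q, in_box La p -> in_box La q -> Rabs (g p - g q) <= L * dist1 p q) ->
  exists p, in_box La p /\ forall q, in_box La q -> g p <= g q.
Proof.
intros HLa HL.
assert (H : forall w, exists x, 0 <= w <= La ->
  0 <= x <= 1 /\ forall y, 0 <= y <= 1 -> g (w, x) <= g (w, y)).
{ intros w; destruct (classic (0 <= w <= La)) as [Hw|Hw].
  - destruct (lipschitz_min (fun x => g (w, x)) 0 1 L) as [x Hx]; [lra | |exists x; auto].
    intros x y Hx Hy.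
    replace (Rabs (x - y)) with (dist1 (w, x) (w, y)).
    + apply HL; split; assumption.
    + unfold dist1; simpl; rewrite Rminus_diag, Rabs_R0; ring.
  - exists 0; contradiction. }
pose (xi := fun w => proj1_sig (constructive_indefinite_description _ (H w))).
assert (Hxi : forall w, 0 <= w <= La ->
  0 <= xi w <= 1 /\ forall y, 0 <= y <= 1 -> g (w, xi w) <= g (w, y)).
{ intros w; exact (proj2_sig (constructive_indefinite_description _ (H w))). }
assert (D : forall w1 w2, 0 <= w1 <= La -> 0 <= w2 <= La ->
  g (w1, xi w1) - g (w2, xi w2) <= L * Rabs (w1 - w2)).
{ intros w1 w2 H1 H2.
  destruct (Hxi w1 H1) as [_ A]; destruct (Hxi w2 H2) as [B _].
  specialize (A _ B).
  assert (C := HL (w1, xi w2) (w2, xi w2) (conj H1 B) (conj H2 B)).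
  unfold dist1 in C; simpl in C; rewrite Rminus_diag, Rabs_R0, Rplus_0_r in C.
  assert (E := Rle_abs (g (w1, xi w2) - g (w2, xi w2))); lra. }
destruct (lipschitz_min (fun w => g (w, xi w)) 0 La L HLa) as [w [Hw1 Hw2]].
- intros x y Hx Hy; apply Rabs_le; split; [|apply D; assumption].
  assert (E := D y x Hy Hx); rewrite Rabs_minus_sym in E; lra.
- exists (w, xi w); split.
  + split; [exact Hw1 | exact (proj1 (Hxi w Hw1))].
  + intros [w' x'] [H1 H2]; simpl in *.
    apply Rle_trans with (g (w', xi w')); [apply Hw2; exact H1|].
    apply (Hxi w' H1); exact H2.
Qed.

(** The scheme of [box_min], one atom at a time: after minimizing over the tail, the value is
    Lipschitz in the head with the same constant. This replaces compactness of a box of dimension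
    2k. *)
Lemma list_min La L k : 0 <= La -> forall F : list (R * R) -> R,
  (forall l1 p q l2, length (l1 ++ p :: l2) = k -> Forall (in_box La) (l1 ++ p :: l2) ->
     in_box La q -> Rabs (F (l1 ++ p :: l2) - F (l1 ++ q :: l2)) <= L * dist1 p q) ->
  exists l, (length l = k /\ Forall (in_box La) l) /\
    forall l', length l' = k -> Forall (in_box La) l' -> F l <= F l'.
Proof.
intros HLa; induction k as [|k IH]; intros F HF.
- exists nil; repeat split; [constructor|].
  intros [|p l'] Hl _; [lra | discriminate].
- assert (H : forall p, exists l, in_box La p ->
    (length l = k /\ Forall (in_box La) l) /\
    forall l', length l' = k -> Forall (in_box La) l' -> F (p :: l) <= F (p :: l')).
  { intros p; destruct (classic (in_box La p)) as [Hp|Hp]; [|exists nil; contradiction].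
    destruct (IH (fun l => F (p :: l))) as [l Hl]; [|exists l; auto].
    intros l1 q r l2 H1 H2 H3; apply (HF (p :: l1)); simpl; auto. }
  pose (lm := fun p => proj1_sig (constructive_indefinite_description _ (H p))).
  assert (Hlm : forall p, in_box La p ->
    (length (lm p) = k /\ Forall (in_box La) (lm p)) /\
    forall l', length l' = k -> Forall (in_box La) l' -> F (p :: lm p) <= F (p :: l')).
  { intros p; exact (proj2_sig (constructive_indefinite_description _ (H p))). }
  assert (D : forall p q, in_box La p -> in_box La q ->
    F (p :: lm p) - F (q :: lm q) <= L * dist1 p q).
  { intros p q Hp Hq.
    destruct (Hlm p Hp) as [_ A]; destruct (Hlm q Hq) as [[B1 B2] _].
    specialize (A _ B1 B2).
    assert (C := HF nil p q (lm q)); simpl in C.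
    assert (E := Rle_abs (F (p :: lm q) - F (q :: lm q))).
    assert (C' := C ltac:(auto) ltac:(auto) Hq); lra. }
  destruct (box_min La (fun p => F (p :: lm p)) L HLa) as [p [Hp1 Hp2]].
  + intros p q Hp Hq; apply Rabs_le; split; [|apply D; assumption].
    assert (E := D q p Hq Hp); rewrite dist1_sym in E; lra.
  + destruct (Hlm p Hp1) as [[B1 B2] _].
    exists (p :: lm p); repeat split; simpl; auto.
    intros [|q l'] Hl Hb; [discriminate|].
    assert (Hq := Forall_inv Hb); assert (Hl' := Forall_inv_tail Hb).
    apply Rle_trans with (F (q :: lm q)); [apply Hp2; assumption|].
    apply Hlm; auto.
Qed.

(** * Dependence of the energy on a single atom, and existence of a minimizer *)

Lemma lin_oppm_app A l g : lin (A ++ oppm l) g = lin A g - lin l g.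
Proof. rewrite lin_app, lin_oppm; ring. Qed.

Lemma energy_app mu nu : energy (mu ++ nu) = energy mu + 2 * lin nu (pot mu) + energy nu.
Proof.
unfold energy.
rewrite (lin_ext_all _ (pot (mu ++ nu)) (fun t => pot mu t + pot nu t)).
- rewrite lin_plus, !lin_app.
  replace (lin mu (pot nu)) with (lin nu (pot mu)); [ring|].
  unfold pot; rewrite lin_swap; apply lin_ext_all; intros t.
  apply lin_ext_all; intros s; apply ker_sym.
- intros t; unfold pot; apply lin_app.
Qed.

Lemma pot_Permutation l1 l2 t : Permutation l1 l2 -> pot l1 t = pot l2 t.
Proof. intros H; apply lin_Permutation, H. Qed.

Lemma energy_Permutation l1 l2 : Permutation l1 l2 -> energy l1 = energy l2.
Proof.
intros H; unfold energy; rewrite (lin_Permutation _ _ _ H).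
apply lin_ext_all; intros t; apply pot_Permutation, H.
Qed.

(** The energy is quadratic in one weight, with coefficients given by the potential of the remaining
    measure and the diagonal of [ker]. All variations of a minimizer are read off from this
    identity. *)
Lemma energy_atom A l1 l2 w x :
  energy (A ++ oppm (l1 ++ (w, x) :: l2)) =
  energy (A ++ oppm (l1 ++ l2)) - 2 * w * pot (A ++ oppm (l1 ++ l2)) x + w ^ 2 * ker x x.
Proof.
rewrite (energy_Permutation _ ((A ++ oppm (l1 ++ l2)) ++ ((- w, x) :: nil))).
- rewrite energy_app; unfold energy at 2; unfold pot at 2; simpl; ring.
- rewrite <- app_assoc; apply Permutation_app_head.
  unfold oppm; rewrite !map_app; simpl; rewrite <- app_assoc.
  apply Permutation_app_head. apply Permutation_cons_append.
Qed.

Lemma pot_atom A l1 l2 w x t :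
  pot (A ++ oppm (l1 ++ (w, x) :: l2)) t = pot (A ++ oppm (l1 ++ l2)) t - w * ker x t.
Proof. unfold pot; rewrite !lin_oppm_app, !lin_app; simpl; ring. Qed.

Lemma ker_bounds s t : 0 <= s <= 1 -> 0 <= t <= 1 -> Rabs (ker s t) <= 2.
Proof.
assert (W : forall s t, 0 <= s <= 1 -> 0 <= t <= 1 -> t <= s -> Rabs (ker s t) <= 2).
{ clear; intros s t Hs Ht H; unfold ker; rewrite ppart_left by lra.
  assert (0 <= (1 - s) ^ 2 <= 1) by (split; nra).
  assert (0 <= (1 - s) ^ 3 <= 1) by (split; [apply pow_le; lra|]; simpl in *; nra).
  assert (0 <= (1 - t) * (1 - s) ^ 2 <= 1) by (split; nra).
  apply Rabs_le; lra. }
intros Hs Ht; destruct (Rle_dec t s); [|rewrite ker_sym]; apply W; lra.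
Qed.

Lemma ker_lipschitz s t u : 0 <= s <= 1 -> 0 <= t <= 1 -> 0 <= u <= 1 ->
  Rabs (ker s t - ker s u) <= 2 * Rabs (t - u).
Proof.
intros Hs Ht Hu.
assert (W : forall a b, 0 <= a <= 1 -> 0 <= b <= 1 -> Rabs (a ^ 3 - b ^ 3) <= 3 * Rabs (a - b)).
{ clear; intros a b Ha Hb.
  replace (a ^ 3 - b ^ 3) with ((a ^ 2 + a * b + b ^ 2) * (a - b)) by ring.
  rewrite Rabs_mult; apply Rmult_le_compat_r; [apply Rabs_pos|].
  apply Rabs_le; split; nra. }
assert (B : forall x, 0 <= x <= 1 -> 0 <= ppart (x - s) <= 1).
{ intros x Hx; split; [apply ppart_nonneg|]; unfold ppart, Rmax; destruct Rle_dec; lra. }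
assert (H1 := W _ _ (B t Ht) (B u Hu)).
assert (H2 := ppart_lipschitz (t - s) (u - s)).
replace (t - s - (u - s)) with (t - u) in H2 by ring.
replace (ker s t - ker s u) with
  ((ppart (t - s) ^ 3 - ppart (u - s) ^ 3) / 6 - (t - u) * ((1 - s) ^ 2 / 2))
  by (unfold ker; field).
assert (H3 : 0 <= (1 - s) ^ 2 / 2 <= 1 / 2) by (split; nra).
assert (H4 : Rabs ((t - u) * ((1 - s) ^ 2 / 2)) <= Rabs (t - u) * (1 / 2)).
{ rewrite Rabs_mult; apply Rmult_le_compat_l; [apply Rabs_pos|].
  rewrite Rabs_pos_eq; lra. }
unfold Rminus at 1; eapply Rle_trans; [apply Rabs_triang|].
rewrite Rabs_Ropp.
assert (H5 : Rabs ((ppart (t - s) ^ 3 - ppart (u - s) ^ 3) / 6) <= Rabs (t - u) / 2).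
{ unfold Rdiv; rewrite Rabs_mult, (Rabs_pos_eq (/ 6)) by lra; lra. }
assert (H6 := Rabs_pos (t - u)).
lra.
Qed.

Lemma pot_bound mu t : supported mu -> 0 <= t <= 1 ->
  Rabs (pot mu t) <= total_variation mu * 2.
Proof. intros Hm Ht; apply lin_abs_le; intros p Hp; apply ker_bounds; auto. Qed.

Lemma pot_lipschitz mu t u : supported mu -> 0 <= t <= 1 -> 0 <= u <= 1 ->
  Rabs (pot mu t - pot mu u) <= total_variation mu * (2 * Rabs (t - u)).
Proof.
intros Hm Ht Hu; unfold pot.
replace (lin mu (fun s => ker s t) - lin mu (fun s => ker s u)) with
  (lin mu (fun s => ker s t + -1 * ker s u))
  by (rewrite lin_plus, lin_scal; ring).
apply lin_abs_le; intros p Hp.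
replace (ker (snd p) t + -1 * ker (snd p) u) with (ker (snd p) t - ker (snd p) u) by ring.
apply ker_lipschitz; auto.
Qed.

Lemma total_variation_app l1 l2 :
  total_variation (l1 ++ l2) = total_variation l1 + total_variation l2.
Proof. unfold total_variation; induction l1 as [|p l IH]; simpl; [|rewrite IH]; ring. Qed.

Lemma total_variation_box La l : Forall (in_box La) l ->
  total_variation (oppm l) <= INR (length l) * La.
Proof.
induction 1 as [|p l [Hp _] _ IH]; [simpl; lra|].
change (length (p :: l)) with (S (length l)); rewrite S_INR; simpl in *.
rewrite Rabs_Ropp, Rabs_pos_eq by lra; lra.
Qed.

Lemma supported_app l1 l2 : supported l1 -> supported l2 -> supported (l1 ++ l2).
Proof. intros H1 H2 p Hp; apply in_app_or in Hp; destruct Hp; auto. Qed.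

Lemma supported_oppm l : supported l -> supported (oppm l).
Proof.
intros H p Hp; unfold oppm in Hp; apply in_map_iff in Hp.
destruct Hp as [q [<- Hq]]; simpl; auto.
Qed.

Lemma supported_box La l : Forall (in_box La) l -> supported l.
Proof. intros H p Hp; rewrite Forall_forall in H; apply (H p Hp). Qed.

Lemma Rabs_mult_le a b A B : Rabs a <= A -> Rabs b <= B -> Rabs (a * b) <= A * B.
Proof.
intros; rewrite Rabs_mult; apply Rmult_le_compat; auto using Rabs_pos.
Qed.

Lemma energy_min_exists A La m : supported A -> 0 <= La ->
  exists l, (length l = m /\ Forall (in_box La) l) /\
    forall l', length l' = m -> Forall (in_box La) l' ->
      energy (A ++ oppm l) <= energy (A ++ oppm l').
Proof.
intros HA HLa.
pose (T := total_variation A + INR m * La).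
assert (HT : 0 <= T).
{ assert (H1 := total_variation_nonneg A); assert (H2 := pos_INR m); unfold T; nra. }
(* The four summands are the bounds [E1], [E3] for a change of weight and [E2], [E4] for a change of
   position; [T] bounds the total variation of the measure without the moving atom. *)
apply (list_min La (4 * T + 4 * La * T + 4 * La + 4 * La ^ 2) m HLa
  (fun l => energy (A ++ oppm l))).
intros l1 [w x] [w' x'] l2 Hlen Hbox Hq.
assert (Hp : in_box La (w, x)).
{ rewrite Forall_forall in Hbox; apply Hbox, in_or_app; right; left; reflexivity. }
assert (Hbox' : Forall (in_box La) (l1 ++ l2)).
{ apply Forall_app in Hbox; destruct Hbox as [H1 H2]; inversion H2; subst.
  apply Forall_app; auto. }
pose (mu := A ++ oppm (l1 ++ l2)).
assert (Hmu : supported mu).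
{ apply supported_app; [exact HA | apply supported_oppm, (supported_box La), Hbox']. }
assert (HTmu : total_variation mu <= T).
{ unfold mu, T; rewrite total_variation_app.
  assert (H1 := total_variation_box La _ Hbox').
  assert (H2 : INR (length (l1 ++ l2)) <= INR m).
  { apply le_INR; rewrite length_app in *; simpl in Hlen; lia. }
  nra. }
rewrite !energy_atom; fold mu.
destruct Hp as [Hw Hx]; destruct Hq as [Hw' Hx']; simpl in *.
assert (P1 := pot_bound mu x Hmu Hx).
assert (P2 := pot_lipschitz mu x x' Hmu Hx Hx').
assert (P0 := total_variation_nonneg mu).
assert (K1 := ker_bounds x x Hx Hx).
assert (K2 : Rabs (ker x x - ker x' x') <= 4 * Rabs (x - x')).
{ replace (ker x x - ker x' x') with ((ker x x - ker x x') + (ker x' x - ker x' x'))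
    by (rewrite (ker_sym x x'); ring).
  assert (H1 := ker_lipschitz x x x' Hx Hx Hx').
  assert (H2 := ker_lipschitz x' x x' Hx' Hx Hx').
  eapply Rle_trans; [apply Rabs_triang | lra]. }
unfold dist1; simpl.
set (dw := Rabs (w - w')); set (dx := Rabs (x - x')).
assert (Hdw : 0 <= dw) by apply Rabs_pos.
assert (Hdx : 0 <= dx) by apply Rabs_pos.
replace (_ - _) with
  (- ((2 * (w - w')) * pot mu x) - (2 * w') * (pot mu x - pot mu x')
   + ((w - w') * (w + w')) * ker x x + w' ^ 2 * (ker x x - ker x' x')) by ring.
assert (E1 : Rabs ((2 * (w - w')) * pot mu x) <= (2 * dw) * (2 * T)).
{ apply Rabs_mult_le; [rewrite Rabs_mult, (Rabs_pos_eq 2) by lra; unfold dw; lra | lra]. }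
assert (E2 : Rabs ((2 * w') * (pot mu x - pot mu x')) <= (2 * La) * (T * (2 * dx))).
{ apply Rabs_mult_le; [rewrite Rabs_pos_eq; lra|].
  eapply Rle_trans; [exact P2|]; apply Rmult_le_compat_r; unfold dx in *; lra. }
assert (E3 : Rabs (((w - w') * (w + w')) * ker x x) <= (dw * (2 * La)) * 2).
{ apply Rabs_mult_le; [|exact K1].
  apply Rabs_mult_le; [unfold dw; lra | rewrite Rabs_pos_eq; lra]. }
assert (E4 : Rabs (w' ^ 2 * (ker x x - ker x' x')) <= La ^ 2 * (4 * dx)).
{ apply Rabs_mult_le; [|exact K2]. rewrite Rabs_pos_eq; nra. }
eapply Rle_trans; [apply Rabs_triang|].
eapply Rle_trans; [apply Rplus_le_compat_r, Rabs_triang|].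
eapply Rle_trans; [apply Rplus_le_compat_r, Rplus_le_compat_r, Rabs_triang|].
rewrite !Rabs_Ropp.
assert (0 <= La * T) by nra.
assert (0 <= La * dw) by nra. assert (0 <= La * T * dw) by nra.
assert (0 <= T * dx) by nra. assert (0 <= La * dx) by nra.
assert (0 <= La ^ 2 * dw) by nra. assert (0 <= La ^ 2 * dx) by nra.
nra.
Qed.

(** * Counting the kinks of a minimizer *)

Lemma rolle (f f' : R -> R) a b : (forall x, is_derive f x (f' x)) ->
  a < b -> f a = f b -> exists c, a < c < b /\ f' c = 0.
Proof.
intros Hf Hab Heq.
destruct (MVT_cor2 f f' a b Hab) as [c [H1 H2]].
- intros c _; apply is_derive_Reals, Hf.
- exists c; split; [exact H2|]. nra.
Qed.

Lemma ddpot_affine mu u v : (forall p, In p mu -> ~ u < snd p < v) ->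
  exists al be, forall t, u <= t <= v -> ddpot mu t = al + be * t.
Proof.
induction mu as [|p mu IH]; intros H.
- exists 0, 0; intros; unfold ddpot; simpl; ring.
- destruct IH as [al [be IH]]; [intros q Hq; apply H; right; exact Hq|].
  assert (Hp := H p (or_introl eq_refl)).
  destruct (Rle_dec (snd p) u) as [H1|H1].
  + exists (al - fst p * snd p), (be + fst p); intros t Ht.
    change (ddpot (p :: mu) t) with (fst p * ppart (t - snd p) + ddpot mu t).
    rewrite IH, ppart_right by lra; ring.
  + exists al, be; intros t Ht.
    change (ddpot (p :: mu) t) with (fst p * ppart (t - snd p) + ddpot mu t).
    rewrite IH, ppart_left by lra; ring.
Qed.

Lemma ddpot_zero mu u v z1 z2 : (forall p, In p mu -> ~ u < snd p < v) ->
  u <= z1 -> z1 < z2 -> z2 <= v -> ddpot mu z1 = 0 -> ddpot mu z2 = 0 ->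
  forall t, u <= t <= v -> ddpot mu t = 0.
Proof.
intros H Hu Hz Hv E1 E2 t Ht.
destruct (ddpot_affine mu u v H) as [al [be Haff]].
rewrite Haff in * by lra.
assert (be = 0) by nra. subst; lra.
Qed.

Lemma isolated (mu : list (R * R)) x :
  exists d, 0 < d /\ forall p, In p mu -> snd p <> x -> d <= Rabs (snd p - x).
Proof.
induction mu as [|p mu [d [Hd IH]]].
- exists 1; split; [lra | intros ? []].
- destruct (Req_dec (snd p) x) as [E|E].
  + exists d; split; [exact Hd|]; intros q [->|Hq] Hne; [contradiction | auto].
  + exists (Rmin d (Rabs (snd p - x))); split.
    * apply Rmin_pos; [exact Hd | apply Rabs_pos_lt; lra].
    * intros q [->|Hq] Hne; [apply Rmin_r|].
      eapply Rle_trans; [apply Rmin_l | auto].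
Qed.

(** Near [x] the spline of [mu] is affine, and an affine function cannot cancel a genuine kink. *)
Lemma ddpot_kink mu b x u v : (forall p, In p mu -> snd p <> x) -> u < x < v ->
  (forall t, u <= t <= v -> ddpot mu t - b * ppart (t - x) = 0) -> b = 0.
Proof.
intros Hmu Hx Hz.
destruct (isolated mu x) as [d [Hd Hgap]].
pose (e := Rmin d (Rmin (x - u) (v - x))).
assert (He : 0 < e) by (repeat apply Rmin_pos; lra).
assert (He1 : e <= d) by apply Rmin_l.
assert (He2 : e <= x - u) by (eapply Rle_trans; [apply Rmin_r | apply Rmin_l]).
assert (He3 : e <= v - x) by (eapply Rle_trans; [apply Rmin_r | apply Rmin_r]).
destruct (ddpot_affine mu (x - e) (x + e)) as [al [be Haff]].
- intros p Hp Hin; assert (H := Hgap p Hp (Hmu p Hp)).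
  assert (Rabs (snd p - x) < e) by (apply Rabs_def1; lra). lra.
- assert (Z1 := Hz (x - e) ltac:(lra)); assert (Z2 := Hz x ltac:(lra));
  assert (Z3 := Hz (x + e) ltac:(lra)).
  rewrite Haff in Z1, Z2, Z3 by lra.
  rewrite ppart_left in Z1, Z2 by lra; rewrite ppart_right in Z3 by lra.
  assert (b * e = 0) by lra. nra.
Qed.

Definition count_lt (l : list R) (x : R) : nat :=
  length (filter (fun t => if Rlt_dec t x then true else false) l).

Lemma count_lt_split l x y : x <= y ->
  count_lt l y = (count_lt l x +
    length (filter (fun t => if Rlt_dec t x then false
                             else if Rlt_dec t y then true else false) l))%nat.
Proof.
intros H; unfold count_lt; induction l as [|t l IH]; [reflexivity|]; simpl.
destruct (Rlt_dec t x); destruct (Rlt_dec t y); simpl; lra || lia.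
Qed.

Lemma count_lt_one l x y t : In t l -> x <= t < y -> (count_lt l x + 1 <= count_lt l y)%nat.
Proof.
intros Ht Hxy; rewrite (count_lt_split l x y) by lra.
apply Nat.add_le_mono_l, (NoDup_incl_length (l := t :: nil)).
- repeat constructor; simpl; tauto.
- intros s [<-|[]]; apply filter_In; split; [exact Ht|].
  destruct (Rlt_dec t x); [lra|]; destruct (Rlt_dec t y); [reflexivity | lra].
Qed.

Lemma count_lt_two l x y t s : In t l -> In s l -> t <> s -> x <= t < y -> x <= s < y ->
  (count_lt l x + 2 <= count_lt l y)%nat.
Proof.
intros Ht Hs Hts Hxt Hxs; rewrite (count_lt_split l x y) by lra.
apply Nat.add_le_mono_l, (NoDup_incl_length (l := t :: s :: nil)).
- repeat constructor; simpl; intuition.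
- intros r [<-|[<-|[]]]; apply filter_In; split; try assumption.
  + destruct (Rlt_dec t x); [lra|]; destruct (Rlt_dec t y); [reflexivity | lra].
  + destruct (Rlt_dec s x); [lra|]; destruct (Rlt_dec s y); [reflexivity | lra].
Qed.

Lemma count_lt_le l x : (count_lt l x <= length l)%nat.
Proof. apply filter_length_le. Qed.

(* Between consecutive double zeros of the potential its second derivative, which is
   piecewise linear, has two zeros. Hence either there is an atom of [A] in between or
   the second derivative vanishes there, and the latter can only happen at the cost of a
   second atom of [A] in the preceding gap. *)
Lemma double_zeros_count (A : list (R * R)) (x b : nat -> R) (l : list (R * R)) m :
  (forall p, In p l -> exists i, (i < m)%nat /\ snd p = x i) ->
  (forall i, (i < m)%nat -> 0 < b i /\
     exists l0, Permutation l ((b i, x i) :: l0) /\ forall p, In p l0 -> snd p <> x i) ->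
  (forall i j, (i < j)%nat -> (j < m)%nat -> x i < x j) ->
  (forall i, (1 <= i)%nat -> (S i < m)%nat ->
     pot (A ++ oppm l) (x i) = 0 /\ dpot (A ++ oppm l) (x i) = 0) ->
  (m <= length A + 4)%nat.
Proof.
intros Hl Hb Hx Hz.
set (mu := A ++ oppm l) in *.
set (taus := map snd A).
assert (Hmu : forall p, In p mu -> In (snd p) taus \/ exists i, (i < m)%nat /\ snd p = x i).
{ intros p Hp; apply in_app_or in Hp; destruct Hp as [Hp|Hp].
  - left; apply in_map, Hp.
  - right; unfold oppm in Hp; apply in_map_iff in Hp; destruct Hp as [q [<- Hq]].
    apply (Hl q Hq). }
assert (Hgap : forall i j, (S i < m)%nat -> (j < m)%nat -> ~ x i < x j < x (S i)).
{ intros i j Hi Hj [H1 H2].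
  destruct (Nat.lt_trichotomy i j) as [H|[H|H]].
  - destruct (Nat.eq_dec j (S i)) as [->|Hne]; [lra|].
    assert (H3 := Hx (S i) j ltac:(lia) Hj); lra.
  - subst; lra.
  - assert (H3 := Hx j i H ltac:(lia)); lra. }
(* Rolle for the potential gives a zero c of its derivative, which also vanishes at both double
   zeros; Rolle on either side of c gives the two zeros. *)
assert (Htwo : forall i, (1 <= i)%nat -> (S (S i) < m)%nat -> exists z1 z2,
  x i < z1 /\ z1 < z2 /\ z2 < x (S i) /\ ddpot mu z1 = 0 /\ ddpot mu z2 = 0).
{ intros i H1 H2.
  destruct (Hz i H1 ltac:(lia)) as [A1 B1]; destruct (Hz (S i) ltac:(lia) H2) as [A2 B2].
  assert (Hlt := Hx i (S i) ltac:(lia) ltac:(lia)).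
  destruct (rolle (pot mu) (dpot mu) (x i) (x (S i))) as [c [Hc Hc0]];
    [apply is_derive_pot | exact Hlt | congruence |].
  destruct (rolle (dpot mu) (ddpot mu) (x i) c) as [z1 [Hz1 E1]];
    [apply is_derive_dpot | lra | congruence |].
  destruct (rolle (dpot mu) (ddpot mu) c (x (S i))) as [z2 [Hz2 E2]];
    [apply is_derive_dpot | lra | congruence |].
  exists z1, z2; repeat split; lra. }
assert (Hnull : forall i, (1 <= i)%nat -> (S (S i) < m)%nat ->
  (forall t, In t taus -> ~ x i < t < x (S i)) ->
  forall t, x i <= t <= x (S i) -> ddpot mu t = 0).
{ intros i H1 H2 Hno.
  destruct (Htwo i H1 H2) as [z1 [z2 [Z1 [Z2 [Z3 [Z4 Z5]]]]]].
  apply (ddpot_zero mu _ _ z1 z2); try lra.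
  intros p Hp Hin; destruct (Hmu p Hp) as [Ht|[j [Hj Ej]]].
  - exact (Hno _ Ht Hin).
  - rewrite Ej in Hin; apply (Hgap i j); [lia | exact Hj | exact Hin]. }
assert (Hstep : forall i, (1 <= i)%nat -> (S (S (S i)) < m)%nat ->
  (count_lt taus (x (S i)) + 1 <= count_lt taus (x (S (S i))))%nat \/
  (count_lt taus (x i) + 2 <= count_lt taus (x (S (S i))))%nat).
{ intros i H1 H2.
  assert (L1 := Hx i (S i) ltac:(lia) ltac:(lia)).
  assert (L2 := Hx (S i) (S (S i)) ltac:(lia) ltac:(lia)).
  destruct (classic (exists t, In t taus /\ x (S i) <= t < x (S (S i)))) as [[t [T1 T2]]|Hno].
  { left; apply (count_lt_one taus _ _ t T1 T2). }
  right.
  destruct (classic (exists t s, In t taus /\ In s taus /\ t <> s /\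
     x i < t < x (S i) /\ x i < s < x (S i))) as [[t [s [T1 [T2 [T3 [T4 T5]]]]]]|Hno2].
  { apply (count_lt_two taus _ _ t s); auto; lra. }
  exfalso.
  (* At this point the gap contains at most one position of [A]. If there is none, the midpoint is a
     harmless substitute for [c]. *)
  assert (Hc : exists c, x i < c < x (S i) /\
    forall t, In t taus -> x i < t < x (S i) -> t = c).
  { destruct (classic (exists t, In t taus /\ x i < t < x (S i))) as [[c [C1 C2]]|Hno3].
    - exists c; split; [exact C2|]; intros t T1 T2.
      destruct (Req_dec t c) as [E|E]; [exact E|].
      exfalso; apply Hno2; exists t, c; auto.
    - exists ((x i + x (S i)) / 2); split; [lra|]; intros t T1 T2.
      exfalso; apply Hno3; exists t; auto. }
  destruct Hc as [c [Hc1 Hc2]].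
  assert (Hpts : forall u v, x i <= u -> v <= x (S i) -> ~ u < c < v ->
    forall p, In p mu -> ~ u < snd p < v).
  { intros u v Hu Hv Huv p Hp Hin; destruct (Hmu p Hp) as [Ht|[j [Hj Ej]]].
    - rewrite (Hc2 _ Ht) in Hin by lra; contradiction.
    - rewrite Ej in Hin; apply (Hgap i j); [lia | exact Hj | lra]. }
  assert (Hright : forall t, x (S i) <= t <= x (S (S i)) -> ddpot mu t = 0).
  { apply Hnull; [lia | lia |].
    intros t T1 T2; apply Hno; exists t; split; [exact T1 | lra]. }
  (* [ddpot mu] is affine on each side of [c] and vanishes at z1, z2 and [x (S i)]. Either z2 lies
     on the right piece, which then has two zeros, or z1 and z2 both lie on the left piece, which
     then vanishes up to [c] and gives the right piece its second zero. *)
  assert (Hleft : forall t, c <= t <= x (S i) -> ddpot mu t = 0).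
  { destruct (Htwo i H1 ltac:(lia)) as [z1 [z2 [Z1 [Z2 [Z3 [Z4 Z5]]]]]].
    destruct (Rle_dec c z2) as [Hcz|Hcz].
    - apply (ddpot_zero mu _ _ z2 (x (S i))); try lra.
      + apply Hpts; lra.
      + apply Hright; lra.
    - apply (ddpot_zero mu _ _ c (x (S i))); try lra.
      + apply Hpts; lra.
      + apply (ddpot_zero mu (x i) c z1 z2); try lra.
        apply Hpts; lra.
      + apply Hright; lra. }
  (* The second derivative vanishes on both sides of [x (S i)], where the only contribution is the
     atom of [l] with weight [b (S i) > 0]. *)
  destruct (Hb (S i) ltac:(lia)) as [Hpos [l0 [Hperm Hl0]]].
  assert (Hb0 : b (S i) = 0); [|lra].
  apply (ddpot_kink (A ++ oppm l0) (b (S i)) (x (S i)) c (x (S (S i)))).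
  - intros p Hp E; apply in_app_or in Hp; destruct Hp as [Hp|Hp].
    + apply Hno; exists (snd p); split; [apply in_map, Hp | lra].
    + unfold oppm in Hp; apply in_map_iff in Hp; destruct Hp as [q [<- Hq]].
      exact (Hl0 q Hq E).
  - lra.
  - intros t Ht.
    transitivity (ddpot mu t).
    + unfold mu, ddpot; rewrite !lin_oppm_app, (lin_Permutation _ _ _ Hperm); simpl; ring.
    + destruct (Rle_dec t (x (S i))); [apply Hleft | apply Hright]; lra. }
(* Two consecutive indices are carried along because [Hstep] may refer two steps back. The slack 2
   pays for the start at the indices 1 and 2. As the last double zero has index m - 2, the final
   bound is m - 2 <= length A + 2. *)
assert (Hcount : forall i, (1 <= i)%nat -> (S i < m)%nat ->
  (i <= count_lt taus (x i) + 2)%nat /\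
  ((S (S i) < m)%nat -> (S i <= count_lt taus (x (S i)) + 2)%nat)).
{ intros i H1; induction H1 as [|i H1 IH]; intros H2; [split; lia|].
  destruct (IH ltac:(lia)) as [I1 I2]; specialize (I2 H2).
  split; [exact I2|]; intros H3.
  destruct (Hstep i H1 H3); lia. }
destruct (Nat.le_gt_cases m 4) as [Hm|Hm]; [lia|].
destruct (Hcount (m - 2)%nat ltac:(lia) ltac:(lia)) as [H _].
assert (H1 := count_lt_le taus (x (m - 2)%nat)).
unfold taus in *; rewrite length_map in H1; lia.
Qed.

(** * First-order conditions at a minimizer *)

Lemma quadratic_nonneg_right a k d : 0 < d ->
  (forall h, 0 < h <= d -> 0 <= - 2 * h * a + h ^ 2 * k) -> a <= 0.
Proof.
intros Hd H; destruct (Rle_dec a 0) as [Ha|Ha]; [exact Ha|]; exfalso.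
pose (h := Rmin d (a / (Rabs k + 1))).
assert (Hk := Rabs_pos k); assert (Hk' := Rle_abs k).
assert (Hq : 0 < a / (Rabs k + 1)) by (apply Rdiv_lt_0_compat; lra).
assert (Hh : 0 < h) by (apply Rmin_pos; lra).
assert (H1 : h <= d) by apply Rmin_l.
assert (H2 : h <= a / (Rabs k + 1)) by apply Rmin_r.
apply (Rmult_le_compat_r (Rabs k + 1)) in H2; [|lra].
replace (a / (Rabs k + 1) * (Rabs k + 1)) with a in H2 by (field; lra).
assert (H3 := H h (conj Hh H1)).
assert (H4 : 0 <= - 2 * a + h * k).
{ apply (Rmult_le_reg_l h); [exact Hh|]; lra. }
nra.
Qed.

Lemma interior_min_derive (f : R -> R) a b c l : a < c < b -> is_derive f c l ->
  (forall x, a < x < b -> f c <= f x) -> l = 0.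
Proof.
intros Hc Hf Hmin; apply is_derive_Reals in Hf.
pose (pr := exist _ l Hf : derivable_pt f c).
assert (H := deriv_minimum f a b c pr (proj1 Hc) (proj2 Hc) (fun x H1 H2 => Hmin x (conj H1 H2))).
exact H.
Qed.

Definition energy_minimizer (A : list (R * R)) (La : R) (l : list (R * R)) : Prop :=
  Forall (in_box La) l /\
  forall l', length l' = length l -> Forall (in_box La) l' ->
    energy (A ++ oppm l) <= energy (A ++ oppm l').

Lemma energy_minimizer_atom A La l1 w x l2 :
  energy_minimizer A La (l1 ++ (w, x) :: l2) ->
  forall w' x', 0 <= w' <= La -> 0 <= x' <= 1 ->
  - 2 * w * pot (A ++ oppm (l1 ++ l2)) x + w ^ 2 * ker x x <=
  - 2 * w' * pot (A ++ oppm (l1 ++ l2)) x' + w' ^ 2 * ker x' x'.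
Proof.
intros [Hbox Hmin] w' x' Hw Hx.
assert (H := Hmin (l1 ++ (w', x') :: l2)).
rewrite !energy_atom in H.
assert (H' : Forall (in_box La) (l1 ++ (w', x') :: l2)).
{ apply Forall_app in Hbox; destruct Hbox as [H1 H2].
  apply Forall_app; split; [exact H1|].
  constructor; [split; assumption | apply (Forall_inv_tail H2)]. }
specialize (H ltac:(rewrite !length_app; reflexivity) H'); lra.
Qed.

(** Raising the weight by h changes the energy by -2 h pot + h^2 ker, which must be nonnegative; w <
    La leaves room for this. Lowering a positive weight gives the reverse inequality in
    [minimizer_pot_eq]. *)
Lemma minimizer_pot_le A La l1 w x l2 :
  energy_minimizer A La (l1 ++ (w, x) :: l2) -> 0 <= w < La -> 0 <= x <= 1 ->
  pot (A ++ oppm (l1 ++ (w, x) :: l2)) x <= 0.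
Proof.
intros Hmin Hw Hx; rewrite pot_atom.
set (mu := A ++ oppm (l1 ++ l2)).
apply (quadratic_nonneg_right _ (ker x x) (La - w)); [lra|]; intros h Hh.
assert (H := energy_minimizer_atom _ _ _ _ _ _ Hmin (w + h) x ltac:(lra) Hx).
fold mu in H; lra.
Qed.

Lemma minimizer_pot_eq A La l1 w x l2 :
  energy_minimizer A La (l1 ++ (w, x) :: l2) -> 0 < w < La -> 0 <= x <= 1 ->
  pot (A ++ oppm (l1 ++ (w, x) :: l2)) x = 0.
Proof.
intros Hmin Hw Hx.
apply Rle_antisym; [apply (minimizer_pot_le A La); auto; lra|].
rewrite pot_atom; set (mu := A ++ oppm (l1 ++ l2)).
enough (- (pot mu x - w * ker x x) <= 0) by lra.
apply (quadratic_nonneg_right _ (ker x x) w); [lra|]; intros h Hh.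
assert (H := energy_minimizer_atom _ _ _ _ _ _ Hmin (w - h) x ltac:(lra) Hx).
fold mu in H; lra.
Qed.

(** Vary the position. As [ker] is symmetric, its diagonal has twice the partial derivative, so the
    derivative of the energy is -2 w times the derivative of the full potential. *)
Lemma minimizer_dpot_eq A La l1 w x l2 :
  energy_minimizer A La (l1 ++ (w, x) :: l2) -> 0 < w <= La -> 0 < x < 1 ->
  dpot (A ++ oppm (l1 ++ (w, x) :: l2)) x = 0.
Proof.
intros Hmin Hw Hx.
set (mu := A ++ oppm (l1 ++ l2)).
assert (E : dpot (A ++ oppm (l1 ++ (w, x) :: l2)) x = dpot mu x + w * ((1 - x) ^ 2 / 2)).
{ unfold mu, dpot; rewrite !lin_oppm_app, !lin_app; simpl.
  rewrite ppart_left by lra; field. }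
rewrite E.
assert (H : - 2 * w * dpot mu x + w ^ 2 * (- (1 - x) ^ 2) = 0); [|nra].
apply (interior_min_derive
  (fun t => - 2 * w * pot mu t + w ^ 2 * (1 + (1 - t) ^ 3 / 3)) 0 1 x _ Hx).
- apply (is_derive_plus (fun t => - 2 * w * pot mu t)).
  + apply (is_derive_scal (pot mu)), is_derive_pot.
  + auto_derive; [exact I | field].
- intros t Ht; rewrite <- !ker_diag.
  apply (energy_minimizer_atom _ _ _ _ _ _ Hmin); lra.
Qed.

(** An atom of weight 0 can be moved to any [t] without changing the energy; raising its weight
    there gives the sign of the potential at [t]. *)
Lemma minimizer_free_slot A La l1 x l2 :
  energy_minimizer A La (l1 ++ (0, x) :: l2) -> 0 < La ->
  forall t, 0 <= t <= 1 -> pot (A ++ oppm (l1 ++ (0, x) :: l2)) t <= 0.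
Proof.
intros Hmin HLa t Ht; rewrite pot_atom.
set (mu := A ++ oppm (l1 ++ l2)).
replace (pot mu t - 0 * ker x t) with (pot mu t) by ring.
apply (quadratic_nonneg_right _ (ker t t) La); [lra|]; intros h Hh.
assert (H := energy_minimizer_atom _ _ _ _ _ _ Hmin h t ltac:(lra) Ht).
fold mu in H; lra.
Qed.

(** * From a minimizer to the positive comparison measure *)

Lemma lin_zero l g : (forall p, In p l -> fst p * g (snd p) = 0) -> lin l g = 0.
Proof.
induction l as [|p l IH]; simpl; intros H; [reflexivity|].
rewrite (H p) by auto; rewrite IH by auto; ring.
Qed.

Lemma mass_ge_in l p : (forall q, In q l -> 0 <= fst q) -> In p l -> fst p <= mass l.
Proof.
unfold mass; induction l as [|q l IH]; simpl; intros Hpos [].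
- subst q; assert (0 <= lin l (fun _ => 1)); [|lra].
  replace 0 with (lin l (fun _ => 0)).
  + apply lin_le; intros; [auto | lra].
  + apply lin_zero; intros; ring.
- assert (fst p <= lin l (fun _ => 1)) by auto.
  assert (0 <= fst q) by auto; lra.
Qed.

Lemma NoDup_or_split (l : list (R * R)) :
  NoDup (map snd l) \/
  exists l1 w l2 w' x l3, l = l1 ++ (w, x) :: l2 ++ (w', x) :: l3.
Proof.
induction l as [|[w x] l [IH|(l1 & w1 & l2 & w2 & y & l3 & E)]].
- left; constructor.
- destruct (in_dec Req_EM_T x (map snd l)) as [H|H].
  + right; apply in_map_iff in H; destruct H as [[w' x'] [E H]]; simpl in E; subst.
    apply in_split in H; destruct H as [l2 [l3 ->]].
    exists nil, w, l2, w', x, l3; reflexivity.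
  + left; constructor; assumption.
- right; exists ((w, x) :: l1), w1, l2, w2, y, l3; rewrite E; reflexivity.
Qed.

Lemma insert_sorted (p : R * R) l : ~ In (snd p) (map snd l) ->
  StronglySorted (fun p q => snd p < snd q) l ->
  exists l', Permutation (p :: l) l' /\ StronglySorted (fun p q => snd p < snd q) l'.
Proof.
induction l as [|q l IH]; simpl; intros Hp Hl.
- exists (p :: nil); split; [reflexivity | repeat constructor].
- inversion Hl as [|? ? Hl1 Hl2]; subst.
  destruct (Rlt_dec (snd p) (snd q)) as [H|H].
  + exists (p :: q :: l); split; [reflexivity|].
    constructor; [exact Hl|]; constructor; [exact H|].
    eapply Forall_impl; [|exact Hl2]; simpl; intros; lra.
  + destruct IH as [l' [P S]]; [tauto | exact Hl1|].
    exists (q :: l'); split; [rewrite perm_swap; constructor; exact P|].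
    constructor; [exact S|].
    rewrite Forall_forall in *; intros r Hr.
    apply (Permutation_in _ (Permutation_sym P)) in Hr; destruct Hr as [<-|Hr]; [|auto].
    destruct (Req_dec (snd q) (snd p)); [exfalso; tauto | lra].
Qed.

Lemma sort_exists (l : list (R * R)) : NoDup (map snd l) ->
  exists l', Permutation l l' /\ StronglySorted (fun p q => snd p < snd q) l'.
Proof.
induction l as [|p l IH]; simpl; intros H.
- exists nil; split; constructor.
- inversion H as [|? ? H1 H2]; subst.
  destruct (IH H2) as [l1 [P1 S1]].
  destruct (insert_sorted p l1) as [l2 [P2 S2]]; [|exact S1|].
  + intros Hin; apply H1, (Permutation_in _ (Permutation_map snd (Permutation_sym P1))), Hin.
  + exists l2; split; [rewrite P1; exact P2 | exact S2].
Qed.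

Lemma StronglySorted_nth (l : list (R * R)) d i j :
  StronglySorted (fun p q => snd p < snd q) l -> (i < j)%nat -> (j < length l)%nat ->
  snd (nth i l d) < snd (nth j l d).
Proof.
intros H; revert i j; induction H as [|p l Hl IH Hp]; simpl; intros i j Hij Hj; [lia|].
destruct j as [|j]; [lia|]; destruct i as [|i].
- rewrite Forall_forall in Hp; apply Hp, nth_In; lia.
- apply IH; lia.
Qed.

(** This makes the artificial bound [La] on the weights inactive. A mass of at least [La] would make
    the mass of the difference at least [energy A + 1] in absolute value, hence its square, and so
    the energy, larger than [energy A]. *)
Lemma mass_lt_of_energy A l La : supported A -> supported l ->
  La = Rabs (mass A) + energy A + 1 -> energy (A ++ oppm l) <= energy A -> mass l < La.
Proof.
intros HA Hl -> HE.
assert (H1 := energy_ge A HA).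
assert (H2 := energy_ge (A ++ oppm l) (supported_app _ _ HA (supported_oppm _ Hl))).
assert (E : mass (A ++ oppm l) = mass A - mass l) by (unfold mass; apply lin_oppm_app).
rewrite E in H2; clear E.
assert (H3 := Rle_abs (mass A)).
assert (H4 : 0 <= energy A) by nra.
destruct (Rlt_dec (mass l) (Rabs (mass A) + energy A + 1)) as [H|H]; [exact H|]; exfalso.
assert ((energy A + 1) ^ 2 <= (mass A - mass l) ^ 2) by nra.
nra.
Qed.

(* By [double_zeros_count] an energy minimizer with [length A + 5] atoms has a spare atom, for
   which optimality reads [pot <= 0]. *)
Lemma positive_balayage A : supported A ->
  exists l, (length l <= length A + 5)%nat /\ supported l /\ (forall p, In p l -> 0 <= fst p) /\
    (forall t, 0 <= t <= 1 -> pot (A ++ oppm l) t <= 0) /\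
    lin l (pot (A ++ oppm l)) = 0.
Proof.
intros HA.
pose (La := Rabs (mass A) + energy A + 1).
assert (HLa : 0 < La).
{ unfold La; assert (H1 := energy_ge A HA); assert (H2 := Rabs_pos (mass A)); nra. }
(* One more than [double_zeros_count] permits. *)
set (m := (length A + 5)%nat).
destruct (energy_min_exists A La m HA ltac:(lra)) as [l [[Hlen Hbox] Hmin]].
(* The zero measure as a competitor: a minimizer has energy at most [energy A], as
   [mass_lt_of_energy] requires. *)
assert (Hzero : energy (A ++ oppm (repeat (0, 0) m)) = energy A).
{ assert (Z : forall k g, lin (oppm (repeat (0, 0) k)) g = 0).
  { induction k; intros g; simpl; [reflexivity|]; rewrite IHk; ring. }
  rewrite energy_app; unfold energy at 2; rewrite !Z; ring. }
assert (Hmass : forall l', length l' = m -> Forall (in_box La) l' ->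
  energy (A ++ oppm l') = energy (A ++ oppm l) -> mass l' < La).
{ intros l' H1 H2 E; apply (mass_lt_of_energy A l' La HA); [apply (supported_box La), H2 | reflexivity|].
  rewrite E, <- Hzero; apply Hmin; [apply repeat_length|].
  apply Forall_forall; intros p Hp; apply repeat_spec in Hp; subst; split; simpl; lra. }
assert (Hnonneg : forall l', Forall (in_box La) l' -> forall p, In p l' -> 0 <= fst p).
{ intros l' H p Hp; rewrite Forall_forall in H; apply (H p Hp). }
(* Any minimizer with a zero weight proves the lemma: that atom gives the sign of the potential, and
   at atoms of positive weight the potential vanishes. *)
assert (Hfree : forall l1 x l2, length (l1 ++ (0, x) :: l2) = m ->
  Forall (in_box La) (l1 ++ (0, x) :: l2) ->
  energy (A ++ oppm (l1 ++ (0, x) :: l2)) = energy (A ++ oppm l) ->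
  exists l, (length l <= m)%nat /\ supported l /\ (forall p, In p l -> 0 <= fst p) /\
    (forall t, 0 <= t <= 1 -> pot (A ++ oppm l) t <= 0) /\
    lin l (pot (A ++ oppm l)) = 0).
{ intros l1 x l2 H1 H2 E; set (l' := l1 ++ (0, x) :: l2) in *.
  assert (M : energy_minimizer A La l').
  { split; [exact H2|]; intros l'' H3 H4; rewrite E; apply Hmin; congruence. }
  exists l'; split; [lia|]; split; [apply (supported_box La), H2|].
  split; [apply Hnonneg, H2|].
  split; [apply (minimizer_free_slot A La); assumption|].
  apply lin_zero; intros [w y] Hp.
  assert (Hw := Hnonneg l' H2 _ Hp).
  assert (HwLa := mass_ge_in l' _ (Hnonneg l' H2) Hp).
  assert (Hm := Hmass l' H1 H2 E).
  simpl in *; destruct (Req_dec w 0) as [->|Hw0]; [ring|].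
  destruct (in_split _ _ Hp) as [k1 [k2 Ek]].
  rewrite Ek in M |- *; rewrite (minimizer_pot_eq A La k1 w y k2 M); [ring | lra |].
  apply (supported_box La l' H2 _ Hp). }
assert (Hmin0 : energy_minimizer A La l).
{ split; [exact Hbox|]; intros l' H; apply Hmin; congruence. }
destruct (NoDup_or_split l) as [Hnd|(l1 & w & l2 & w' & x & l3 & E)].
(* Two atoms at the same position are merged, which keeps the measure and frees one slot. The mass
   bound keeps the merged weight inside the box. *)
2: { assert (Hml := Hmass l Hlen Hbox eq_refl).
  assert (Hperm : Permutation l ((w, x) :: (w', x) :: (l1 ++ l2 ++ l3))).
  { rewrite E; rewrite <- Permutation_middle; apply perm_skip.
    rewrite app_assoc, <- Permutation_middle, <- app_assoc; reflexivity. }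
  assert (Hbox' := Hbox); rewrite Forall_forall in Hbox'.
  assert (Hin1 : in_box La (w, x)).
  { apply Hbox', (Permutation_in _ (Permutation_sym Hperm)); left; reflexivity. }
  assert (Hin2 : in_box La (w', x)).
  { apply Hbox', (Permutation_in _ (Permutation_sym Hperm)); right; left; reflexivity. }
  assert (Hrest : Forall (in_box La) (l1 ++ l2 ++ l3)).
  { apply Forall_forall; intros p Hp.
    apply Hbox', (Permutation_in _ (Permutation_sym Hperm)); right; right; exact Hp. }
  assert (Hww : w + w' < La).
  { eapply Rle_lt_trans; [|exact Hml].
    unfold mass; rewrite (lin_Permutation _ _ _ Hperm); simpl.
    enough (0 <= lin (l1 ++ l2 ++ l3) (fun _ => 1)) by lra.
    replace 0 with (lin (l1 ++ l2 ++ l3) (fun _ => 0)).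
    - apply lin_le; [apply Hnonneg, Hrest | intros; lra].
    - apply lin_zero; intros; ring. }
  destruct Hin1 as [A1 A2]; destruct Hin2 as [B1 B2]; simpl in *.
  apply (Hfree nil x ((w + w', x) :: l1 ++ l2 ++ l3)).
  - apply Permutation_length in Hperm; simpl in *; lia.
  - simpl; constructor; [split; simpl; lra|]; constructor; [split; simpl; lra | exact Hrest].
  - assert (Hlin : forall g, lin (A ++ oppm (nil ++ (0, x) :: (w + w', x) :: l1 ++ l2 ++ l3)) g =
      lin (A ++ oppm l) g).
    { intros g; rewrite !lin_oppm_app, (lin_Permutation _ _ g Hperm); simpl; ring. }
    unfold energy; rewrite Hlin; apply lin_ext_all; intros t; apply Hlin. }
destruct (classic (exists p, In p l /\ fst p = 0)) as [[[w x] [Hp E]]|Hpos].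
{ simpl in E; subst w; apply in_split in Hp; destruct Hp as [l1 [l2 E]].
  apply (Hfree l1 x l2); rewrite <- E; auto. }
exfalso.
destruct (sort_exists l Hnd) as [s [Hperm Hsort]].
assert (Hls : length s = m) by (rewrite <- (Permutation_length Hperm); exact Hlen).
assert (Hsbox : Forall (in_box La) s).
{ apply (Permutation_Forall Hperm), Hbox. }
assert (Hlin : forall g, lin (A ++ oppm s) g = lin (A ++ oppm l) g).
{ intros g; rewrite !lin_oppm_app, (lin_Permutation _ _ g Hperm); ring. }
assert (HE : energy (A ++ oppm s) = energy (A ++ oppm l)).
{ unfold energy; rewrite Hlin; apply lin_ext_all; intros t; apply Hlin. }
assert (Hsmin : energy_minimizer A La s).
{ split; [exact Hsbox|]; intros l' H1 H2; rewrite HE; apply Hmin; congruence. }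
assert (Hsmass := Hmass s Hls Hsbox HE).
assert (Hspos : forall p, In p s -> 0 < fst p < La).
{ intros p Hp; assert (H1 := Hnonneg s Hsbox p Hp).
  assert (H2 := mass_ge_in s p (Hnonneg s Hsbox) Hp).
  assert (fst p <> 0); [|lra].
  intros H0; apply Hpos; exists p; split; [|exact H0].
  apply (Permutation_in _ (Permutation_sym Hperm)), Hp. }
pose (x := fun i => snd (nth i s (0, 0))).
pose (b := fun i => fst (nth i s (0, 0))).
assert (Hnth : forall i, (i < m)%nat -> exists s1 s2, s = s1 ++ (b i, x i) :: s2).
{ intros i Hi; apply in_split; unfold b, x; rewrite <- surjective_pairing.
  apply nth_In; lia. }
assert (Hlt : forall i j, (i < j)%nat -> (j < m)%nat -> x i < x j).
{ intros i j H1 H2; apply StronglySorted_nth; [exact Hsort | exact H1 | lia]. }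
assert (Hx01 : forall i, (i < m)%nat -> 0 <= x i <= 1).
{ intros i Hi; apply (supported_box La s Hsbox (nth i s (0, 0))), nth_In; lia. }
assert (Hcount := double_zeros_count A x b s m).
enough (m <= length A + 4)%nat by (unfold m in *; lia).
apply Hcount.
- intros p Hp; destruct (In_nth s p (0, 0) Hp) as [i [Hi E]].
  exists i; split; [lia | unfold x; rewrite E; reflexivity].
- intros i Hi; destruct (Hnth i Hi) as [s1 [s2 E]]; split.
  + apply (Hspos (b i, x i)); rewrite E; apply in_or_app; right; left; reflexivity.
  + exists (s1 ++ s2); split; [rewrite E; symmetry; apply Permutation_middle|].
    intros p Hp Ep.
    assert (Hnd' : NoDup (map snd s)).
    { apply (Permutation_NoDup (Permutation_map snd Hperm) Hnd). }
    rewrite E, map_app in Hnd'; simpl in Hnd'; apply NoDup_remove_2 in Hnd'.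
    apply Hnd'; rewrite <- map_app, <- Ep; apply in_map, Hp.
- exact Hlt.
(* The first and last atoms may sit at 0 and 1, where the position cannot be varied both ways. The
   others lie strictly between them, hence in the open interval. *)
- intros i H1 H2; destruct (Hnth i ltac:(lia)) as [s1 [s2 E]].
  assert (Hbi : 0 < b i < La).
  { apply (Hspos (b i, x i)); rewrite E; apply in_or_app; right; left; reflexivity. }
  assert (X0 := Hx01 0%nat ltac:(lia)); assert (X1 := Hlt 0%nat i H1 ltac:(lia)).
  assert (X2 := Hlt i (S i) ltac:(lia) H2); assert (X3 := Hx01 (S i) H2).
  rewrite E in Hsmin |- *; split.
  + apply (minimizer_pot_eq A La); [exact Hsmin | exact Hbi | lra].
  + apply (minimizer_dpot_eq A La); [exact Hsmin | lra | lra].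
Qed.

(** * Quadratic approximation by piecewise linear functions *)

(** The tangent of the convex function h^5 at t. Being affine in h, it can be summed over pieces of
    unequal length. *)
Lemma tangent_pow5 h t : 0 <= h -> 0 <= t -> 5 * t ^ 4 * h - 4 * t ^ 5 <= h ^ 5.
Proof.
intros Hh Ht.
assert (E : h ^ 5 - (5 * t ^ 4 * h - 4 * t ^ 5) =
  (h - t) ^ 2 * (h ^ 3 + 2 * h ^ 2 * t + 3 * h * t ^ 2 + 4 * t ^ 3)) by ring.
assert (0 <= (h - t) ^ 2 * (h ^ 3 + 2 * h ^ 2 * t + 3 * h * t ^ 2 + 4 * t ^ 3)); [|lra].
assert (0 <= h ^ 3) by (apply pow_le; lra). assert (0 <= t ^ 3) by (apply pow_le; lra).
assert (0 <= h ^ 2 * t) by (apply Rmult_le_pos; [apply pow_le|]; lra).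
assert (0 <= h * t ^ 2) by (apply Rmult_le_pos; [|apply pow_le]; lra).
apply Rmult_le_pos; [apply pow2_ge_0 | lra].
Qed.

Lemma RInt_parabola_sqr al be u v : u <= v ->
  (v - u) ^ 5 / 720 <= RInt (fun x => (x ^ 2 / 2 - (al + be * x)) ^ 2) u v.
Proof.
intros Huv.
rewrite (RInt_of_derive (fun x =>
  x ^ 5 / 20 - al * x ^ 3 / 3 - be * x ^ 4 / 4 + al ^ 2 * x + al * be * x ^ 2 + be ^ 2 * x ^ 3 / 3)).
(* Centred at the midpoint, the integral becomes the minimum h^5/720 plus one square each for the
   errors in slope and in height. *)
- pose (h := v - u); pose (c := (u + v) / 2).
  pose (B := be - c); pose (Al := al + be * c - c ^ 2 / 2).
  assert (E : v ^ 5 / 20 - al * v ^ 3 / 3 - be * v ^ 4 / 4 + al ^ 2 * v + al * be * v ^ 2 + be ^ 2 * v ^ 3 / 3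
    - (u ^ 5 / 20 - al * u ^ 3 / 3 - be * u ^ 4 / 4 + al ^ 2 * u + al * be * u ^ 2 + be ^ 2 * u ^ 3 / 3)
    = h ^ 5 / 720 + B ^ 2 * h ^ 3 / 12 + h * (Al - h ^ 2 / 24) ^ 2).
  { unfold h, B, Al, c; field. }
  rewrite E; fold h.
  assert (Hh : 0 <= h) by (unfold h; lra).
  assert (0 <= B ^ 2 * h ^ 3) by (apply Rmult_le_pos; [apply pow2_ge_0 | apply pow_le, Hh]).
  assert (0 <= h * (Al - h ^ 2 / 24) ^ 2) by (apply Rmult_le_pos; [exact Hh | apply pow2_ge_0]).
  lra.
- intros x; auto_derive; [exact I | field].
- intros x; apply (ex_derive_continuous (fun x => (x ^ 2 / 2 - (al + be * x)) ^ 2)).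
  auto_derive; exact I.
Qed.

Definition atoms_between (nu : list (R * R)) (u v : R) : list (R * R) :=
  filter (fun p => if Rlt_dec u (snd p) then if Rlt_dec (snd p) v then true else false else false) nu.

Lemma atoms_between_split nu u x v : u < x < v -> (exists p, In p nu /\ snd p = x) ->
  (length (atoms_between nu u x) + length (atoms_between nu x v) + 1
     <= length (atoms_between nu u v))%nat.
Proof.
intros Hx.
assert (W : forall nu, (length (atoms_between nu u x) + length (atoms_between nu x v)
     <= length (atoms_between nu u v))%nat).
{ clear nu; induction nu as [|p nu IH]; [reflexivity|]; unfold atoms_between in *; simpl.
  repeat destruct Rlt_dec; simpl; lra || lia. }
intros [p [Hp E]]; destruct (in_split _ _ Hp) as [n1 [n2 ->]].
unfold atoms_between in *; rewrite !filter_app, !length_app; simpl.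
assert (W1 := W n1); assert (W2 := W n2).
repeat destruct Rlt_dec; simpl; lra || lia.
Qed.

Lemma continuous_parabola_sub nu x : continuous (fun x => x ^ 2 / 2 - ddpot nu x) x.
Proof.
apply (continuous_minus (fun x => x ^ 2 / 2)).
- apply (ex_derive_continuous (fun x => x ^ 2 / 2)); auto_derive; exact I.
- apply continuous_ddpot.
Qed.

Lemma continuous_sqr (f : R -> R) x : continuous f x -> continuous (fun x => f x ^ 2) x.
Proof.
intros H; apply (continuous_ext (fun x => f x * f x)); [intros; simpl; ring|].
apply (continuous_mult f f); exact H.
Qed.

(** Split at any kink and use induction: the bound is affine in the length and in the number of
    pieces, so the two halves add up. Taking [t] as the length of equal pieces later makes it sharp
    enough. *)
Lemma parabola_distance nu t : 0 < t -> forall k u v, u <= v ->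
  (length (atoms_between nu u v) <= k)%nat ->
  (5 * t ^ 4 * (v - u) - 4 * INR (S k) * t ^ 5) / 720 <=
  RInt (fun x => (x ^ 2 / 2 - ddpot nu x) ^ 2) u v.
Proof.
intros Ht; induction k as [k IH] using lt_wf_ind; intros u v Huv Hk.
assert (Ht5 : 0 < t ^ 5) by (apply pow_lt, Ht).
destruct (classic (exists p, In p nu /\ u < snd p < v)) as [[p [Hp Hpuv]]|Hno].
- assert (Hs := atoms_between_split nu u (snd p) v Hpuv (ex_intro _ p (conj Hp eq_refl))).
  set (x := snd p) in *.
  set (k1 := length (atoms_between nu u x)) in *.
  set (k2 := length (atoms_between nu x v)) in *.
  assert (I1 := IH k1 ltac:(lia) u x ltac:(lra) (le_n _)).
  assert (I2 := IH k2 ltac:(lia) x v ltac:(lra) (le_n _)).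
  rewrite <- (RInt_Chasles _ u x v);
    [|apply ex_RInt_of_continuous; intros; apply continuous_sqr, continuous_parabola_sub..].
  unfold plus; simpl.
  assert (HS : INR (S k1) + INR (S k2) <= INR (S k)).
  { rewrite <- plus_INR; apply le_INR; lia. }
  assert (HS' := Rmult_le_compat_r (t ^ 5) _ _ (Rlt_le _ _ Ht5) HS).
  enough ((5 * t ^ 4 * (v - u) - 4 * INR (S k) * t ^ 5) / 720 <=
    (5 * t ^ 4 * (x - u) - 4 * INR (S k1) * t ^ 5) / 720 +
    (5 * t ^ 4 * (v - x) - 4 * INR (S k2) * t ^ 5) / 720) by (simpl in *; lra).
  lra.
- destruct (ddpot_affine nu u v) as [al [be Haff]].
  { intros p Hp Hpuv; apply Hno; exists p; auto. }
  rewrite (RInt_ext _ (fun x => (x ^ 2 / 2 - (al + be * x)) ^ 2)).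
  + eapply Rle_trans; [|apply RInt_parabola_sqr, Huv].
    assert (T := tangent_pow5 (v - u) t ltac:(lra) ltac:(lra)).
    assert (1 <= INR (S k)) by (rewrite S_INR; assert (H := pos_INR k); lra).
    nra.
  + rewrite Rmin_left, Rmax_right by lra.
    intros x Hx; rewrite Haff by lra; reflexivity.
Qed.

(** * The lower bound for positive definite formulae *)

Lemma Cr_of_derive r (d : nat -> R -> R) :
  (forall k x, (k < r)%nat -> is_derive (d k) x (d (S k) x)) ->
  (forall x, continuous (d r) x) -> is_Cr_with_derivatives r (d O) d.
Proof.
intros Hd Hc; split; [reflexivity | split].
- intros k x Hk _.
  apply (D_in_imp _ _ no_cond); [intros; exact I|].
  apply derivable_pt_lim_D_in, is_derive_Reals, Hd, Hk.
- intros x _ eps He.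
  assert (H : continuity_pt (d r) x) by (apply continuity_pt_filterlim, Hc).
  destruct (H eps He) as [al [Hal H']].
  exists al; split; [exact Hal|]; intros y [[_ Hy] Hy']; apply H'.
  repeat split; assumption.
Qed.

Definition defect (A : list (R * R)) (g : R -> R) : R := remainder (lin A) g.

Lemma quadrature_list N Q : is_quadrature N Q ->
  exists A, length A = N /\ supported A /\ forall f, Q f = lin A f.
Proof.
intros [a [tau [Ht [_ HQ]]]].
exists (map (fun i => (a i, tau i)) (seq 1 N)); split; [|split].
- rewrite length_map, length_seq; reflexivity.
- intros p Hp; apply in_map_iff in Hp; destruct Hp as [i [<- Hi]].
  apply in_seq in Hi; simpl; apply Ht; lia.
- intros f; rewrite HQ; clear; induction N as [|N IH].
  + rewrite sum_n_m_zero by lia; reflexivity.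
  + rewrite sum_n_Sm by lia; rewrite seq_S, map_app, lin_app, <- IH; simpl.
    unfold plus; simpl; ring.
Qed.

Lemma lin_minus l g h : lin l (fun x => g x - h x) = lin l g - lin l h.
Proof.
rewrite (lin_ext_all l _ (fun x => g x + -1 * h x)) by (intros; ring).
rewrite lin_plus, lin_scal; ring.
Qed.

Lemma defect_minus A (g h : R -> R) : (forall x, continuous g x) -> (forall x, continuous h x) ->
  defect A (fun x => g x - h x) = defect A g - defect A h.
Proof.
intros Hg Hh; unfold defect, remainder.
assert (E : RInt (fun x => g x - h x) 0 1 = RInt g 0 1 - RInt h 0 1).
{ apply (RInt_minus g h); apply ex_RInt_of_continuous; assumption. }
rewrite E, lin_minus; ring.
Qed.

Lemma defect_lin A l (F : R -> R -> R) : (forall s x, continuous (F s) x) ->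
  defect A (fun x => lin l (fun s => F s x)) = lin l (fun s => defect A (F s)).
Proof.
intros H; unfold defect, remainder; rewrite RInt_lin, lin_minus by exact H.
f_equal; apply (lin_swap A l (fun x s => F s x)).
Qed.

Lemma defect_abs_le A (g : R -> R) B : supported A -> (forall x, continuous g x) ->
  (forall x, 0 <= x <= 1 -> Rabs (g x) <= B) ->
  Rabs (defect A g) <= (1 + total_variation A) * B.
Proof.
intros HA Hg HB; unfold defect, remainder, Rminus.
eapply Rle_trans; [apply Rabs_triang|]; rewrite Rabs_Ropp.
assert (H1 : Rabs (RInt g 0 1) <= (1 - 0) * B).
{ apply abs_RInt_le_const; [lra | apply ex_RInt_of_continuous, Hg | exact HB]. }
assert (H2 := lin_abs_le A g B (fun p Hp => HB _ (HA p Hp))).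
lra.
Qed.

(** The potential of Lebesgue measure on [0,1] for [ker], see [RInt_ker]. The zero coefficients
    match the shape required by [defect_quartic]; the coefficient 1/24 makes the fourth derivative
    1. *)
Definition kint (s : R) : R := 9 / 8 + - (1 / 6) * s + 0 * s ^ 2 + 0 * s ^ 3 + 1 / 24 * s ^ 4.

Lemma continuous_kint x : continuous kint x.
Proof. apply (ex_derive_continuous kint); unfold kint; auto_derive; exact I. Qed.

Lemma RInt_ker s : 0 <= s <= 1 -> kint s = RInt (ker s) 0 1.
Proof.
intros Hs.
rewrite (RInt_of_derive (fun t => / 24 * ppart (t - s) ^ 4 +
  ((1 - (1 - s) ^ 3 / 6) * t - (1 - t) ^ 2 * (1 - s) ^ 2 / 4)) (ker s)).
- rewrite (ppart_right (1 - s)), (ppart_left (0 - s)) by lra; unfold kint; field.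
- intros t; evar_last.
  + apply (is_derive_plus (fun t => / 24 * ppart (t - s) ^ 4)).
    * apply (is_derive_scal (fun x => ppart (x - s) ^ 4)), (is_derive_ppart_shift 2).
    * auto_derive; [exact I | reflexivity].
  + unfold plus, ker; simpl; field.
- apply continuous_ker.
Qed.

Lemma kint_RInt s : 0 <= s <= 1 ->
  kint s = 1 + RInt (fun x => ppart (x - s) * (x ^ 2 / 2)) 0 1.
Proof.
intros Hs.
rewrite (RInt_of_derive (fun x => / 8 * ppart (x - s) ^ 4 + (s / 3 * ppart (x - s) ^ 3 + s ^ 2 / 4 * ppart (x - s) ^ 2))).
- rewrite (ppart_right (1 - s)), (ppart_left (0 - s)) by lra; unfold kint; field.
- intros t; evar_last.
  + apply (is_derive_plus (fun t => / 8 * ppart (t - s) ^ 4)).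
    * apply (is_derive_scal (fun x => ppart (x - s) ^ 4)), (is_derive_ppart_shift 2).
    * apply (is_derive_plus (fun t => s / 3 * ppart (t - s) ^ 3)).
      -- apply (is_derive_scal (fun x => ppart (x - s) ^ 3)), (is_derive_ppart_shift 1).
      -- apply (is_derive_scal (fun x => ppart (x - s) ^ 2)), (is_derive_ppart_shift 0).
  + unfold plus; simpl. destruct (Rle_dec t s).
    * rewrite ppart_left by lra; field.
    * rewrite ppart_right by lra; field.
- intros t; apply (continuous_mult (fun x => ppart (x - s)) (fun x => x ^ 2 / 2)).
  + apply continuous_ppart_shift.
  + apply (ex_derive_continuous (fun x => x ^ 2 / 2)); auto_derive; exact I.
Qed.

Lemma RInt_pot mu : supported mu -> RInt (pot mu) 0 1 = lin mu kint.
Proof.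
intros Hmu; unfold pot; rewrite RInt_lin by (intros; apply continuous_ker).
symmetry; apply lin_ext; intros p Hp; apply RInt_ker; auto.
Qed.

(** Both sides are the energy of Lebesgue measure minus [nu]: the former has mass 1, the parabola
    x^2/2 as its spline, and the potential [kint]. *)
Lemma self_defect nu : supported nu ->
  defect nu (fun s => kint s - pot nu s) =
  (1 - mass nu) ^ 2 + RInt (fun x => (x ^ 2 / 2 - ddpot nu x) ^ 2) 0 1.
Proof.
intros Hnu.
rewrite defect_minus by (apply continuous_kint || apply continuous_pot).
assert (Hq : forall x : R, continuous (fun x => x ^ 2 / 2) x).
{ intros x; apply (ex_derive_continuous (fun x => x ^ 2 / 2)); auto_derive; exact I. }
assert (Hd := continuous_ddpot nu).
unfold defect, remainder; rewrite RInt_pot by exact Hnu.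
change (lin nu (pot nu)) with (energy nu); rewrite energy_eq by exact Hnu.
assert (E1 : lin nu kint = mass nu + RInt (fun x => ddpot nu x * (x ^ 2 / 2)) 0 1).
{ rewrite (RInt_ddpot nu (fun x => x ^ 2 / 2)) by exact Hq.
  unfold mass; rewrite <- lin_plus; apply lin_ext; intros p Hp; apply kint_RInt; auto. }
assert (E2 : 1 + RInt (fun x => x ^ 2 / 2 * (x ^ 2 / 2)) 0 1 = RInt kint 0 1).
{ rewrite (RInt_of_derive (fun s => 9 / 8 * s - s ^ 2 / 12 + s ^ 5 / 120) kint).
  - rewrite (RInt_of_derive (fun s => s ^ 5 / 20) (fun x => x ^ 2 / 2 * (x ^ 2 / 2))).
    + field.
    + intros x; auto_derive; [exact I | field].
    + intros x; apply (continuous_mult (fun x => x ^ 2 / 2) (fun x => x ^ 2 / 2)); apply Hq.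
  - intros x; unfold kint; auto_derive; [exact I | field].
  - apply continuous_kint. }
assert (C1 : forall x, continuous (fun x => x ^ 2 / 2 * (x ^ 2 / 2)) x).
{ intros x; apply (continuous_mult (fun x => x ^ 2 / 2) (fun x => x ^ 2 / 2)); apply Hq. }
assert (C2 : forall x, continuous (fun x => ddpot nu x * (x ^ 2 / 2)) x).
{ intros x; apply (continuous_mult (ddpot nu) (fun x => x ^ 2 / 2)); auto. }
assert (C3 : forall x, continuous (fun x => ddpot nu x * ddpot nu x) x).
{ intros x; apply (continuous_mult (ddpot nu) (ddpot nu)); auto. }
assert (E3 : RInt (fun x => (x ^ 2 / 2 - ddpot nu x) ^ 2) 0 1 =
  RInt (fun x => x ^ 2 / 2 * (x ^ 2 / 2)) 0 1
  - 2 * RInt (fun x => ddpot nu x * (x ^ 2 / 2)) 0 1 + RInt (fun x => ddpot nu x * ddpot nu x) 0 1).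
{ rewrite (RInt_ext _ (fun x => (x ^ 2 / 2 * (x ^ 2 / 2) - 2 * (ddpot nu x * (x ^ 2 / 2)))
      + ddpot nu x * ddpot nu x)) by (intros; refine (_ : @eq R _ _); ring).
  assert (C4 : forall x, continuous (fun x => 2 * (ddpot nu x * (x ^ 2 / 2))) x).
  { intros x; apply (continuous_scal_r 2 (fun x => ddpot nu x * (x ^ 2 / 2))); auto. }
  assert (C5 : forall x, continuous (fun x => x ^ 2 / 2 * (x ^ 2 / 2) - 2 * (ddpot nu x * (x ^ 2 / 2))) x).
  { intros x; apply (continuous_minus (fun x => x ^ 2 / 2 * (x ^ 2 / 2))
      (fun x => 2 * (ddpot nu x * (x ^ 2 / 2)))); auto. }
  etransitivity; [apply (RInt_plus (fun x => x ^ 2 / 2 * (x ^ 2 / 2) - 2 * (ddpot nu x * (x ^ 2 / 2)))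
    (fun x => ddpot nu x * ddpot nu x)); apply ex_RInt_of_continuous; auto|].
  unfold plus; simpl; f_equal.
  etransitivity; [apply (RInt_minus (fun x => x ^ 2 / 2 * (x ^ 2 / 2))
    (fun x => 2 * (ddpot nu x * (x ^ 2 / 2)))); apply ex_RInt_of_continuous; auto|].
  unfold minus, plus, opp; simpl; unfold Rminus; f_equal; f_equal.
  apply (RInt_scal (fun x => ddpot nu x * (x ^ 2 / 2)) 0 1 2), ex_RInt_of_continuous; auto. }
rewrite E1, <- E2, E3; ring.
Qed.

(** * Nonnegativity of the Peano kernel of a positive definite formula *)

Lemma mollified_cube_close eta e x : 0 <= eta <= 1 -> 0 <= x <= 1 -> 0 < e <= 1 ->
  Rabs (ppart (x - eta) ^ 3 - / (20 * e ^ 2) * (ppart (x - (eta - e)) ^ 5 - 2 * ppart (x - eta) ^ 5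
                                         + ppart (x - (eta + e)) ^ 5)) <= 4 * e.
Proof.
intros Heta Hx He.
set (y := x - eta).
replace (x - (eta - e)) with (y + e) by (unfold y; ring).
replace (x - (eta + e)) with (y - e) by (unfold y; ring).
assert (Hy : - 1 <= y <= 1) by (unfold y; lra).
clearbody y; clear x eta Heta Hx.
(* Multiplied by 20 e^2, the error is exactly 10 e^4 y for y >= e and 0 for y <= -e; in between
   every term is of order e^5. *)
assert (W : Rabs (20 * e ^ 2 * ppart y ^ 3 - (ppart (y + e) ^ 5 - 2 * ppart y ^ 5 + ppart (y - e) ^ 5))
  <= 20 * e ^ 2 * (4 * e)).
{ assert (He3 : 0 <= e ^ 3) by (apply pow_le; lra).
  assert (He5 : 0 <= e ^ 5 <= e ^ 3).
  { split; [apply pow_le; lra|]. replace (e ^ 5) with (e ^ 3 * e ^ 2) by ring.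
    rewrite <- (Rmult_1_r (e ^ 3)) at 2; apply Rmult_le_compat_l; nra. }
  destruct (Rle_dec e y) as [H1|H1].
  - rewrite !ppart_right by lra.
    replace (_ - _) with (- (10 * (e ^ 4 * y))) by ring.
    rewrite Rabs_Ropp.
    assert (0 <= e ^ 4 * y <= e ^ 3).
    { split; [apply Rmult_le_pos; [apply pow_le|]; lra|].
      replace (e ^ 4 * y) with (e ^ 3 * (e * y)) by ring.
      rewrite <- (Rmult_1_r (e ^ 3)) at 2; apply Rmult_le_compat_l; nra. }
    rewrite Rabs_pos_eq; lra.
  - destruct (Rle_dec y (- e)) as [H2|H2].
    + rewrite !ppart_left by lra.
      replace (_ - _) with 0 by ring; rewrite Rabs_R0; lra.
    + rewrite (ppart_left (y - e)), (ppart_right (y + e)) by lra.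
      assert (Hp : 0 <= ppart y <= e).
      { split; [apply ppart_nonneg | unfold ppart, Rmax; destruct Rle_dec; lra]. }
      assert (P3 : 0 <= ppart y ^ 3 <= e ^ 3).
      { split; [apply pow_le; lra | apply pow_incr; exact Hp]. }
      assert (P5 : 0 <= ppart y ^ 5 <= e ^ 5).
      { split; [apply pow_le; lra | apply pow_incr; exact Hp]. }
      assert (S5 : 0 <= (y + e) ^ 5 <= 32 * e ^ 5).
      { split; [apply pow_le; lra|]. replace (32 * e ^ 5) with ((2 * e) ^ 5) by ring.
        apply pow_incr; lra. }
      assert (E3 : 0 <= e ^ 2 * ppart y ^ 3 <= e ^ 5).
      { split; [apply Rmult_le_pos; [apply pow2_ge_0 | lra]|].
        replace (e ^ 5) with (e ^ 2 * e ^ 3) by ring.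
        apply Rmult_le_compat_l; [apply pow2_ge_0 | lra]. }
      rewrite (pow_i 5) by lia.
      apply Rabs_le; lra. }
replace (ppart y ^ 3 - _) with
  (/ (20 * e ^ 2) * (20 * e ^ 2 * ppart y ^ 3 - (ppart (y + e) ^ 5 - 2 * ppart y ^ 5 + ppart (y - e) ^ 5)))
  by (field; lra).
assert (He2 : 0 < 20 * e ^ 2) by nra.
rewrite Rabs_mult, Rabs_pos_eq by (left; apply Rinv_0_lt_compat, He2).
apply (Rmult_le_reg_l (20 * e ^ 2)); [exact He2|].
rewrite <- Rmult_assoc, Rinv_r, Rmult_1_l by lra.
exact W.
Qed.

Lemma continuous_ppart_pow n s x : continuous (fun x => ppart (x - s) ^ S (S n)) x.
Proof. apply (ex_derive_continuous (fun x => ppart (x - s) ^ S (S n))); eexists; apply is_derive_ppart_shift. Qed.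

Lemma defect_quartic A c c0 c1 c2 c3 c4 : is_error_constant 4 (lin A) c ->
  defect A (fun x => c0 + c1 * x + c2 * x ^ 2 + c3 * x ^ 3 + c4 * x ^ 4) = 24 * c4 * c.
Proof.
intros [_ Hc].
pose (d := fun k : nat => match k with
  | O => fun x : R => c0 + c1 * x + c2 * x ^ 2 + c3 * x ^ 3 + c4 * x ^ 4
  | 1%nat => fun x => c1 + 2 * c2 * x + 3 * c3 * x ^ 2 + 4 * c4 * x ^ 3
  | 2%nat => fun x => 2 * c2 + 6 * c3 * x + 12 * c4 * x ^ 2
  | 3%nat => fun x => 6 * c3 + 24 * c4 * x
  | _ => fun _ => 24 * c4 end).
assert (Hd : is_Cr_with_derivatives 4 (d O) d).
{ apply Cr_of_derive.
  - intros k x Hk; destruct k as [|[|[|[|k]]]]; [| | | | lia];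
      unfold d; auto_derive; trivial; ring.
  - intros x; apply continuous_const. }
destruct (Hc _ d Hd) as [xi [_ E]].
change (remainder (lin A) (d O) = 24 * c4 * c); rewrite E; simpl; ring.
Qed.

(* [ppart (x - eta) ^ 3] is approximated by a divided second difference of
   [ppart (x - eta) ^ 5], whose fourth derivative is a nonnegative hat function. *)
Lemma mollified_cube_defect_nonneg A c eta e : is_error_constant 4 (lin A) c -> 0 < e ->
  0 <= defect A (fun x => / (20 * e ^ 2) * (ppart (x - (eta - e)) ^ 5 - 2 * ppart (x - eta) ^ 5
                                         + ppart (x - (eta + e)) ^ 5)).
Proof.
intros [Hc0 Hc] He.
pose (D := fun n x => ppart (x - (eta - e)) ^ n - 2 * ppart (x - eta) ^ n
                                         + ppart (x - (eta + e)) ^ n).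
pose (k0 := / (20 * e ^ 2)).
assert (Hk0 : 0 < k0) by (apply Rinv_0_lt_compat; nra).
pose (d := fun k : nat => match k with
  | O => fun x : R => k0 * D 5%nat x
  | 1%nat => fun x => k0 * 5 * D 4%nat x
  | 2%nat => fun x => k0 * 20 * D 3%nat x
  | 3%nat => fun x => k0 * 60 * D 2%nat x
  | _ => fun x => k0 * 120 * D 1%nat x end).
assert (HD : forall n x, is_derive (D (S (S n))) x (INR (S (S n)) * D (S n) x)).
{ intros n x; evar_last.
  - apply (is_derive_plus (fun x => ppart (x - (eta - e)) ^ S (S n) - 2 * ppart (x - eta) ^ S (S n))).
    + apply (is_derive_minus (fun x => ppart (x - (eta - e)) ^ S (S n))
                             (fun x => 2 * ppart (x - eta) ^ S (S n))).
      * apply is_derive_ppart_shift.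
      * apply (is_derive_scal (fun x => ppart (x - eta) ^ S (S n))), is_derive_ppart_shift.
    + apply is_derive_ppart_shift.
  - unfold plus, minus, opp, D; simpl. unfold plus; simpl. ring. }
assert (Hd : is_Cr_with_derivatives 4 (d O) d).
{ apply Cr_of_derive.
  - assert (HD' : forall a n b x, b = a * INR (S (S n)) ->
      is_derive (fun x => a * D (S (S n)) x) x (b * D (S n) x)).
    { intros a n b x ->; rewrite Rmult_assoc; apply (is_derive_scal (D (S (S n)))), HD. }
    intros k x Hk; destruct k as [|[|[|[|k]]]]; [| | | | lia]; unfold d.
    + apply (HD' k0 3%nat); simpl; ring.
    + apply (HD' (k0 * 5) 2%nat); simpl; ring.
    + apply (HD' (k0 * 20) 1%nat); simpl; ring.
    + apply (HD' (k0 * 60) 0%nat); simpl; ring.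
  - intros x; unfold d.
    apply (continuous_scal_r (k0 * 120) (D 1%nat)).
    apply (continuous_plus (fun x => ppart (x - (eta - e)) ^ 1 - 2 * ppart (x - eta) ^ 1)).
    + apply (continuous_minus (fun x => ppart (x - (eta - e)) ^ 1) (fun x => 2 * ppart (x - eta) ^ 1)).
      * apply (continuous_ext (fun x => ppart (x - (eta - e)))); [intros; simpl; ring|].
        apply continuous_ppart_shift.
      * apply (continuous_ext (fun x => 2 * ppart (x - eta))); [intros; simpl; ring|].
        apply (continuous_scal_r 2 (fun x => ppart (x - eta))), continuous_ppart_shift.
    + apply (continuous_ext (fun x => ppart (x - (eta + e)))); [intros; simpl; ring|].
      apply continuous_ppart_shift. }
destruct (Hc _ d Hd) as [xi [_ E]].
change (0 <= remainder (lin A) (d O)); rewrite E; simpl.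
apply Rmult_le_pos; [lra|]; apply Rmult_le_pos; [nra|].
unfold D, ppart, Rmax; simpl; repeat destruct Rle_dec; lra.
Qed.

(** The truncated cube is not of class C^4, so the error formula applies only to its mollification,
    which is uniformly within 4e. Small e excludes a negative value. *)
Lemma cube_defect_nonneg A c eta : supported A -> is_error_constant 4 (lin A) c ->
  0 <= eta <= 1 -> 0 <= defect A (fun x => ppart (x - eta) ^ 3).
Proof.
intros HA Hc Heta.
set (T := 1 + total_variation A).
assert (HT : 0 < T) by (assert (H := total_variation_nonneg A); unfold T; lra).
set (X := defect A (fun x => ppart (x - eta) ^ 3)).
assert (W : forall e, 0 < e <= 1 -> - (T * (4 * e)) <= X).
{ intros e He.
  pose (f := fun x => / (20 * e ^ 2) * (ppart (x - (eta - e)) ^ 5 - 2 * ppart (x - eta) ^ 5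
                                         + ppart (x - (eta + e)) ^ 5)).
  assert (Hf : forall x, continuous f x).
  { intros x; apply (continuous_scal_r (/ (20 * e ^ 2)) (fun x => ppart (x - (eta - e)) ^ 5 -
      2 * ppart (x - eta) ^ 5 + ppart (x - (eta + e)) ^ 5)).
    apply (continuous_plus (fun x => ppart (x - (eta - e)) ^ 5 - 2 * ppart (x - eta) ^ 5)).
    - apply (continuous_minus (fun x => ppart (x - (eta - e)) ^ 5) (fun x => 2 * ppart (x - eta) ^ 5)).
      + apply continuous_ppart_pow.
      + apply (continuous_scal_r 2 (fun x => ppart (x - eta) ^ 5)), continuous_ppart_pow.
    - apply continuous_ppart_pow. }
  assert (Hg : forall x, continuous (fun x => ppart (x - eta) ^ 3) x) by (intros; apply continuous_ppart_pow).
  assert (B : Rabs (defect A (fun x => ppart (x - eta) ^ 3 - f x)) <= T * (4 * e)).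
  { apply defect_abs_le; [exact HA | |].
    - intros x; apply (continuous_minus (fun x => ppart (x - eta) ^ 3) f); auto.
    - intros x Hx; apply mollified_cube_close; assumption. }
  rewrite defect_minus in B by assumption; fold X in B.
  assert (F : 0 <= defect A f) by (apply (mollified_cube_defect_nonneg A c); [exact Hc | lra]).
  apply Rabs_le_between in B; lra. }
destruct (Rle_dec 0 X) as [H|H]; [exact H|]; exfalso.
pose (e := Rmin 1 (- X / (8 * T))).
assert (H1 : 0 < - X / (8 * T)) by (apply Rdiv_lt_0_compat; lra).
assert (H2 : 0 < e <= 1) by (split; [apply Rmin_pos; lra | apply Rmin_l]).
assert (H3 : e <= - X / (8 * T)) by apply Rmin_r.
apply (Rmult_le_compat_l (8 * T)) in H3; [|lra].
replace (8 * T * (- X / (8 * T))) with (- X) in H3 by (field; lra).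
assert (H4 := W e H2); lra.
Qed.

Lemma ker_defect_nonneg A c eta : supported A -> is_error_constant 4 (lin A) c ->
  0 <= eta <= 1 -> 0 <= defect A (ker eta).
Proof.
intros HA Hc Heta.
pose (g := fun x => (-1 + (1 - eta) ^ 3 / 6 - (1 - eta) ^ 2 / 2) + (1 - eta) ^ 2 / 2 * x + 0 * x ^ 2 + 0 * x ^ 3 + 0 * x ^ 4).
assert (Hg : forall x, continuous g x).
{ intros x; apply (ex_derive_continuous g); unfold g; auto_derive; exact I. }
(* [ker eta] is one sixth of the truncated cube minus the affine [g], whose defect is 0. The factor
   1/6 is written as a one-atom measure so that [defect_lin] applies. *)
assert (E : defect A (fun x => lin ((/6, 0) :: nil) (fun _ => ppart (x - eta) ^ 3) - g x) = defect A (ker eta)).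
{ unfold defect, remainder; f_equal; [apply RInt_ext; intros x _ | apply lin_ext_all; intros x];
    unfold g, ker; simpl; field. }
rewrite <- E, defect_minus.
- rewrite (defect_lin A _ (fun _ x => ppart (x - eta) ^ 3)); [|intros; apply continuous_ppart_pow].
  unfold g; rewrite (defect_quartic A c) by exact Hc; simpl.
  assert (H := cube_defect_nonneg A c eta HA Hc Heta); simpl in H; lra.
- intros x; apply (continuous_lin _ (fun _ x => ppart (x - eta) ^ 3)).
  intros; apply continuous_ppart_pow.
- exact Hg.
Qed.

Lemma error_constant_ge A c : supported A -> is_error_constant 4 (lin A) c ->
  1 / (720 * INR (length A + 6) ^ 4) <= c.
Proof.
intros HA Hc; destruct (positive_balayage A HA) as [nu [Hlen [Hnu [Hpos [Hle Hzero]]]]].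
pose (U := fun s => kint s - pot nu s).
assert (H1 : defect A U <= c).
{ unfold U; rewrite defect_minus by (apply continuous_kint || apply continuous_pot).
  unfold kint at 1; rewrite (defect_quartic A c) by exact Hc; unfold pot.
  rewrite defect_lin by (intros; apply continuous_ker).
  assert (H : 0 <= lin nu (fun s => defect A (ker s))); [|lra].
  rewrite <- (lin_zero nu (fun _ => 0)) by (intros; ring).
  apply lin_le; [exact Hpos|]; intros p Hp; apply (ker_defect_nonneg A c); auto. }
(* The difference is the integral of [pot mu], which is at most 0, minus [lin nu (pot mu)], which is
   0; symmetry of [ker] exchanges [mu] and [nu]. *)
assert (H2 : defect nu U <= defect A U).
{ set (mu := A ++ oppm nu) in *.
  assert (Hmu : supported mu) by (apply supported_app; [|apply supported_oppm]; assumption).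
  assert (E1 : lin A kint - lin nu kint = RInt (pot mu) 0 1).
  { rewrite RInt_pot by exact Hmu; unfold mu; rewrite lin_oppm_app; reflexivity. }
  assert (E2 : RInt (pot mu) 0 1 <= 0).
  { replace 0 with (RInt (fun _ => 0) 0 1) at 2
      by (rewrite RInt_const; unfold scal; simpl; unfold mult; simpl; ring).
    apply RInt_le; [lra | apply ex_RInt_of_continuous, continuous_pot
      | apply ex_RInt_of_continuous; intros; apply continuous_const |].
    intros; apply Hle; lra. }
  assert (E3 : lin A (pot nu) - lin nu (pot nu) = 0).
  { rewrite <- lin_oppm_app; fold mu; rewrite <- Hzero; unfold pot.
    rewrite lin_swap; apply lin_ext_all; intros t; apply lin_ext_all; intros s; apply ker_sym. }
  unfold defect, remainder, U; rewrite !lin_minus; lra. }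
unfold U in H2 at 1; rewrite self_defect in H2 by exact Hnu.
set (n := (length A + 6)%nat).
assert (Hn : 0 < INR n) by (apply lt_0_INR; unfold n; lia).
(* At most N + 5 kinks leave at most n = N + 6 pieces; 1/n is their length in the extremal,
   equidistant case. *)
assert (H3 := parabola_distance nu (/ INR n) (Rinv_0_lt_compat _ Hn) (length A + 5) 0 1 ltac:(lra)
  (Nat.le_trans _ _ _ (filter_length_le _ nu) Hlen)).
replace (S (length A + 5)) with n in H3 by (unfold n; lia).
assert (H4 := pow2_ge_0 (1 - mass nu)).
replace (1 / (720 * INR n ^ 4)) with
  ((5 * (/ INR n) ^ 4 * (1 - 0) - 4 * INR n * (/ INR n) ^ 5) / 720) by (field; lra).
lra.
Qed.


(** * Extension of functions of class C^4 *)

Definition clamp01 (x : R) : R := Rmax 0 (Rmin 1 x).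

Lemma clamp01_in x : I01 (clamp01 x).
Proof. unfold I01, clamp01, Rmax, Rmin; repeat destruct Rle_dec; lra. Qed.

Lemma clamp01_id x : I01 x -> clamp01 x = x.
Proof. unfold I01, clamp01, Rmax, Rmin; intros; repeat destruct Rle_dec; lra. Qed.

Lemma clamp01_lipschitz x y : Rabs (clamp01 x - clamp01 y) <= Rabs (x - y).
Proof.
unfold clamp01, Rmax, Rmin; repeat destruct Rle_dec; unfold Rabs; repeat destruct Rcase_abs; lra.
Qed.

Lemma continuous_clamp f : (forall x, I01 x -> continue_in f I01 x) ->
  forall x, continuous (fun t => f (clamp01 t)) x.
Proof.
intros H x; apply continuity_pt_filterlim; intros eps He.
destruct (H (clamp01 x) (clamp01_in x) eps He) as [al [Hal H']].
exists al; split; [exact Hal|]; intros y [_ Hy]; simpl in *; unfold R_dist in *.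
(* [continue_in] speaks only of points different from the base point, and clamping may identify
   distinct points. *)
destruct (Req_dec (clamp01 x) (clamp01 y)) as [E|E].
- rewrite E, Rminus_diag, Rabs_R0; exact He.
- apply H'; split; [split; [apply clamp01_in | exact E]|].
  eapply Rle_lt_trans; [apply clamp01_lipschitz | exact Hy].
Qed.

Lemma D_in_is_derive f d x : 0 < x < 1 -> D_in f d I01 x ->
  is_derive (fun t => f (clamp01 t)) x (d x).
Proof.
intros Hx H; apply is_derive_Reals; intros eps He.
destruct (H eps He) as [al [Hal H']].
assert (Hd : 0 < Rmin al (Rmin x (1 - x))) by (repeat apply Rmin_pos; lra).
exists (mkposreal _ Hd); intros h Hh Hl; simpl in Hl.
assert (L1 : Rabs h < al) by (eapply Rlt_le_trans; [exact Hl | apply Rmin_l]).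
assert (L2 : Rabs h < x).
{ eapply Rlt_le_trans; [exact Hl | eapply Rle_trans; [apply Rmin_r | apply Rmin_l]]. }
assert (L3 : Rabs h < 1 - x).
{ eapply Rlt_le_trans; [exact Hl | eapply Rle_trans; [apply Rmin_r | apply Rmin_r]]. }
apply Rabs_def2 in L2; apply Rabs_def2 in L3.
rewrite !clamp01_id by (unfold I01; lra).
assert (H1 := H' (x + h)); simpl in H1; unfold R_dist in H1.
replace (x + h - x) with h in H1 by ring.
apply H1; split; [split; [unfold I01; lra | lra] | exact L1].
Qed.

(** One-sided derivatives at 0 and 1 are turned into ordinary ones by integrating a continuous
    extension of the derivative. The primitive agrees with [f] on [0,1] by the mean value theorem,
    which needs derivatives in the open interval only. *)
Lemma extend_primitive f g :
  (forall x, I01 x -> D_in f g I01 x) -> (forall x, continuous g x) ->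
  exists F, (forall x, is_derive F x (g x)) /\ forall x, I01 x -> F x = f x.
Proof.
intros Hf Hg.
pose (F := fun x => f 0 + RInt g 0 x).
assert (HF : forall x, is_derive F x (g x)).
{ intros x; unfold F; evar_last.
  - apply (is_derive_plus (fun _ => f 0) (fun x => RInt g 0 x)); [apply is_derive_const|].
    apply (is_derive_RInt g _ 0); [|apply Hg].
    apply filter_forall; intros y; apply (@RInt_correct R_CompleteNormedModule), ex_RInt_of_continuous, Hg.
  - unfold plus, zero; simpl; ring. }
assert (Hcont : forall x, continuous (fun t => f (clamp01 t)) x).
{ apply continuous_clamp; intros x Hx; apply (cont_deriv f g), Hf, Hx. }
exists F; split; [exact HF|]; intros x Hx.
assert (F0 : F 0 = f 0).
{ unfold F; rewrite RInt_point; unfold zero; simpl; ring. }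
destruct (MVT_gen (fun t => f (clamp01 t) - F t) 0 x (fun _ => 0)) as [y [_ E]].
- rewrite Rmin_left, Rmax_right by apply Hx; intros y Hy; evar_last.
  + apply (is_derive_minus (fun t => f (clamp01 t)) F); [|apply HF].
    apply (D_in_is_derive f g); [unfold I01 in Hx; lra|].
    apply Hf; unfold I01 in *; lra.
  + unfold minus, plus, opp; simpl; ring.
- intros y _; apply continuity_pt_filterlim.
  apply (continuous_minus (fun t => f (clamp01 t)) F); [apply Hcont|].
  apply (ex_derive_continuous F); eexists; apply HF.
- rewrite !clamp01_id, F0 in E by (unfold I01 in *; lra); lra.
Qed.

Definition derivative_chain (G : nat -> R -> R) : Prop :=
  (forall k x, (k < 5)%nat -> is_derive (G k) x (G (S k) x)) /\
  (forall x, continuous (G 5%nat) x).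

(* The chain starts with a primitive of [f], so that [G (S k)] extends the [k]-th derivative. *)
Lemma extend_C4 f d : is_Cr_with_derivatives 4 f d ->
  exists G, derivative_chain G /\ (forall x, I01 x -> G 1%nat x = f x) /\
    (forall x, I01 x -> G 5%nat x = d 4%nat x).
Proof.
intros [H0 [Hd Hc]].
pose (G4 := fun x => d 4%nat (clamp01 x)).
assert (C4 : forall x, continuous G4 x) by (apply continuous_clamp, Hc).
assert (E4 : forall x, I01 x -> G4 x = d 4%nat x).
{ intros x Hx; unfold G4; rewrite clamp01_id; auto. }
assert (Step : forall k g, (k < 4)%nat -> (forall x, continuous g x) ->
  (forall x, I01 x -> g x = d (S k) x) ->
  exists F, (forall x, is_derive F x (g x)) /\ (forall x, I01 x -> F x = d k x) /\
    forall x, continuous F x).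
{ intros k g Hk Cg Eg.
  destruct (extend_primitive (d k) g) as [F [F1 F2]].
  - intros x Hx; assert (H := Hd k x Hk Hx); unfold D_in in *; rewrite Eg by exact Hx; exact H.
  - exact Cg.
  - exists F; split; [exact F1|]; split; [exact F2|].
    intros x; apply (ex_derive_continuous F); eexists; apply F1. }
destruct (Step 3%nat G4) as [G3 [D3 [E3 C3]]]; [lia | auto..|].
destruct (Step 2%nat G3) as [G2 [D2 [E2 C2]]]; [lia | auto..|].
destruct (Step 1%nat G2) as [G1 [D1 [E1 C1]]]; [lia | auto..|].
destruct (Step 0%nat G1) as [G0 [D0 [E0 C0]]]; [lia | auto..|].
pose (P := fun x => RInt G0 0 x).
assert (DP : forall x, is_derive P x (G0 x)).
{ intros x; apply (is_derive_RInt G0 _ 0); [|apply C0].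
  apply filter_forall; intros y; apply (@RInt_correct R_CompleteNormedModule), ex_RInt_of_continuous, C0. }
exists (fun k => match k with
  | O => P | 1%nat => G0 | 2%nat => G1 | 3%nat => G2 | 4%nat => G3 | _ => G4 end).
split; [split|split].
- intros k x Hk; destruct k as [|[|[|[|[|k]]]]]; [..|lia]; auto.
- exact C4.
- intros x Hx; rewrite E0, H0 by exact Hx; reflexivity.
- exact E4.
Qed.

(** * The Peano kernel of the formula, cell by cell *)

(** The Taylor form at 0 of a quartic with fourth derivative 1, as every piece of a Peano kernel of
    order 4 has. *)
Definition quartic (c0 c1 c2 c3 y : R) : R :=
  c0 + c1 * y + c2 * y ^ 2 / 2 + c3 * y ^ 3 / 6 + y ^ 4 / 24.

(** The boundary terms of four integrations by parts of the quartic against [G 5]; the last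
    integral, that of [G 1], is kept apart as the increment of [G 0]. *)
Definition boundary_form (G : nat -> R -> R) (p c0 c1 c2 c3 x : R) : R :=
  quartic c0 c1 c2 c3 (x - p) * G 4%nat x
  - (c1 + c2 * (x - p) + c3 * (x - p) ^ 2 / 2 + (x - p) ^ 3 / 6) * G 3%nat x
  + (c2 + c3 * (x - p) + (x - p) ^ 2 / 2) * G 2%nat x
  - (c3 + (x - p)) * G 1%nat x.

Definition quartic_primitive (c0 c1 c2 c3 y : R) : R :=
  c0 * y + c1 * y ^ 2 / 2 + c2 * y ^ 3 / 6 + c3 * y ^ 4 / 24 + y ^ 5 / 120.

Lemma cell_bounds G p c0 c1 c2 c3 a b m M : derivative_chain G -> a <= b ->
  (forall x, a <= x <= b -> 0 <= quartic c0 c1 c2 c3 (x - p)) ->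
  (forall x, a <= x <= b -> m <= G 5%nat x <= M) ->
  m * (quartic_primitive c0 c1 c2 c3 (b - p) - quartic_primitive c0 c1 c2 c3 (a - p)) <=
  (G O b + boundary_form G p c0 c1 c2 c3 b) - (G O a + boundary_form G p c0 c1 c2 c3 a) <=
  M * (quartic_primitive c0 c1 c2 c3 (b - p) - quartic_primitive c0 c1 c2 c3 (a - p)).
Proof.
intros [HG HG5] Hab HP Hm.
pose (P := fun x => quartic c0 c1 c2 c3 (x - p)).
assert (CP : forall x, continuous P x).
{ intros x; apply (ex_derive_continuous P); unfold P, quartic; auto_derive; exact I. }
assert (CPG : forall x, continuous (fun x => P x * G 5%nat x) x).
{ intros x; apply (continuous_mult P (G 5%nat)); auto. }
assert (E : RInt (fun x => P x * G 5%nat x) a b =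
  (G O b + boundary_form G p c0 c1 c2 c3 b) - (G O a + boundary_form G p c0 c1 c2 c3 a)).
{ apply (RInt_of_derive (fun x => G O x + boundary_form G p c0 c1 c2 c3 x)); [|exact CPG].
  intros x.
  assert (D0 := HG 0%nat x ltac:(lia)); assert (D1 := HG 1%nat x ltac:(lia));
  assert (D2 := HG 2%nat x ltac:(lia)); assert (D3 := HG 3%nat x ltac:(lia));
  assert (D4 := HG 4%nat x ltac:(lia)).
  unfold boundary_form, quartic; auto_derive.
  - repeat split; eexists; eassumption.
  - rewrite (is_derive_unique (fun x : R => G 0%nat x) x _ D0),
      (is_derive_unique (fun x : R => G 1%nat x) x _ D1), (is_derive_unique (fun x : R => G 2%nat x) x _ D2),
      (is_derive_unique (fun x : R => G 3%nat x) x _ D3), (is_derive_unique (fun x : R => G 4%nat x) x _ D4).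
    unfold P, quartic; field. }
assert (EP : forall k, RInt (fun x => k * P x) a b =
  k * (quartic_primitive c0 c1 c2 c3 (b - p) - quartic_primitive c0 c1 c2 c3 (a - p))).
{ intros k; rewrite Rmult_minus_distr_l.
  apply (RInt_of_derive (fun x => k * quartic_primitive c0 c1 c2 c3 (x - p))).
  - intros x; unfold P, quartic, quartic_primitive; auto_derive; [exact I | field].
  - intros x; apply (continuous_scal_r k P); auto. }
assert (CK : forall k, ex_RInt (fun x => k * P x) a b).
{ intros k; apply ex_RInt_of_continuous; intros x; apply (continuous_scal_r k P); auto. }
assert (CG : ex_RInt (fun x => P x * G 5%nat x) a b) by (apply ex_RInt_of_continuous, CPG).
rewrite <- E, <- !EP; split; apply RInt_le; auto; intros x Hx;
  assert (H1 : 0 <= P x) by (apply HP; lra); assert (H2 := Hm x ltac:(lra)); nra.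
Qed.

Lemma scaled_quartic_nonneg h (c0 c1 c2 c3 al be y : R) : 0 < h ->
  (forall t, al <= t <= be -> 0 <= quartic c0 c1 c2 c3 t) ->
  al * h <= y <= be * h ->
  0 <= quartic (c0 * h ^ 4) (c1 * h ^ 3) (c2 * h ^ 2) (c3 * h) y.
Proof.
intros Hh H Hy.
assert (E : quartic (c0 * h ^ 4) (c1 * h ^ 3) (c2 * h ^ 2) (c3 * h) y = h ^ 4 * quartic c0 c1 c2 c3 (y / h)).
{ unfold quartic; field; lra. }
rewrite E; apply Rmult_le_pos; [apply pow_le; lra|].
apply H; split; apply (Rmult_le_reg_r h); try exact Hh;
  unfold Rdiv; rewrite ?Rmult_assoc, ?Rinv_l, ?Rmult_1_r by lra; lra.
Qed.

(** The kernel is h^4 (t (1 - t))^2 / 24 with t = (x - a) / h, a shifted Bernoulli polynomial: it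
    belongs to the trapezoidal rule with derivative correction. *)
Lemma middle_cell G a h m M : derivative_chain G -> 0 < h ->
  (forall x, a <= x <= a + h -> m <= G 5%nat x <= M) ->
  m * (h ^ 5 / 720) <=
  G O (a + h) - G O a + h ^ 2 / 12 * (G 2%nat (a + h) - G 2%nat a) - h / 2 * (G 1%nat a + G 1%nat (a + h))
  <= M * (h ^ 5 / 720).
Proof.
intros HG Hh Hm.
assert (H := cell_bounds G a (0 * h ^ 4) (0 * h ^ 3) (1 / 12 * h ^ 2) (- (1 / 2) * h) a (a + h) m M HG
  ltac:(lra)).
assert (H' := H ltac:(intros x Hx; apply (scaled_quartic_nonneg h _ _ _ _ 0 1 (x - a) Hh);
  [intros t Ht; unfold quartic;
   replace (_ + _) with ((t * (1 - t)) ^ 2 / 24) by field; assert (HH := pow2_ge_0 (t * (1 - t))); lra | lra]) Hm).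
clear H; revert H'.
unfold boundary_form, quartic, quartic_primitive.
replace (a - a) with 0 by ring; replace (a + h - a) with h by ring.
replace (_ - (0 * h ^ 4 * 0 + _ + _ + _ + _)) with (h ^ 5 / 720) by field.
intros H; match goal with |- _ <= ?X <= _ => match type of H with _ <= ?Y <= _ =>
  replace X with Y by field end end.
exact H.
Qed.

(** Three quartic pieces whose third derivatives jump by minus the weights times h. At h/2 the last
    one has value 0, slope 0 and second derivative h^2/12, just as the interior kernel. The weight
    71/48 at h/2 is split into 47/48 here and 1/2 from the adjacent interior cell. *)
Lemma left_end G h m M : derivative_chain G -> 0 < h ->
  (forall x, 0 <= x <= h / 2 -> m <= G 5%nat x <= M) ->
  m * (19 / 207360 * h ^ 5) <=
  G O (h / 2) - G O 0 + h ^ 2 / 12 * G 2%nat (h / 2)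
  - h * (- (5 / 48) * G 1%nat 0 + 15 / 16 * G 1%nat (h / 6) - 21 / 16 * G 1%nat (h / 3)
         + 47 / 48 * G 1%nat (h / 2))
  <= M * (19 / 207360 * h ^ 5).
Proof.
intros HG Hh Hm.
assert (H1 := cell_bounds G 0 (0 * h ^ 4) (0 * h ^ 3) (0 * h ^ 2) (5 / 48 * h) 0 (h / 6) m M HG ltac:(lra)).
assert (H2 := cell_bounds G 0 (5 / 6912 * h ^ 4) (- (5 / 384) * h ^ 3) (5 / 32 * h ^ 2) (- (5 / 6) * h)
  (h / 6) (h / 3) m M HG ltac:(lra)).
assert (H3 := cell_bounds G 0 (- (17 / 2304) * h ^ 4) (23 / 384 * h ^ 3) (- (9 / 32) * h ^ 2) (23 / 48 * h)
  (h / 3) (h / 2) m M HG ltac:(lra)).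
assert (K1 := H1 ltac:(intros x Hx; apply (scaled_quartic_nonneg h _ _ _ _ 0 (1 / 6)); [exact Hh | | lra];
  intros t Ht; unfold quartic; assert (0 <= t ^ 3) by (apply pow_le; lra);
  assert (0 <= t ^ 4) by (apply pow_le; lra); lra) ltac:(intros; apply Hm; lra)).
assert (K2 := H2 ltac:(intros x Hx; apply (scaled_quartic_nonneg h _ _ _ _ (1 / 6) (1 / 3)); [exact Hh | | lra];
  intros t Ht; unfold quartic; nra) ltac:(intros; apply Hm; lra)).
assert (K3 := H3 ltac:(intros x Hx; apply (scaled_quartic_nonneg h _ _ _ _ (1 / 3) (1 / 2)); [exact Hh | | lra];
  intros t Ht; unfold quartic;
  replace (_ + _) with ((t - 1 / 2) ^ 2 * (t ^ 2 + 35 / 12 * t - 17 / 24) / 24) by field;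
  assert (0 <= (t - 1 / 2) ^ 2 * (t ^ 2 + 35 / 12 * t - 17 / 24)) by (apply Rmult_le_pos; [apply pow2_ge_0 | nra]);
  lra) ltac:(intros; apply Hm; lra)).
clear H1 H2 H3; revert K1 K2 K3.
unfold boundary_form, quartic, quartic_primitive; intros K1 K2 K3.
rewrite !Rminus_0_r in *.
split; nra.
Qed.

(** The sign is chosen so that the entries 1 and 5, the function and its fourth derivative, are
    reflected without change of sign. *)
Lemma derivative_chain_reflect G : derivative_chain G ->
  derivative_chain (fun k x => (-1) ^ S k * G k (1 - x)).
Proof.
intros [HG HG5]; split.
- intros k x Hk; evar_last.
  + apply (is_derive_scal (fun x => G k (1 - x))).
    apply (is_derive_comp (G k) (fun x => 1 - x)); [apply HG, Hk|].
    auto_derive; [exact I | reflexivity].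
  + unfold scal; simpl; unfold mult; simpl; ring.
- intros x; apply (continuous_scal_r ((-1) ^ 6) (fun x => G 5%nat (1 - x))).
  apply (continuous_comp (fun x => 1 - x) (G 5%nat)); [|apply HG5].
  apply (ex_derive_continuous (fun x => 1 - x)); auto_derive; exact I.
Qed.

Lemma right_end G h m M : derivative_chain G -> 0 < h ->
  (forall x, 1 - h / 2 <= x <= 1 -> m <= G 5%nat x <= M) ->
  m * (19 / 207360 * h ^ 5) <=
  G O 1 - G O (1 - h / 2) - h ^ 2 / 12 * G 2%nat (1 - h / 2)
  - h * (- (5 / 48) * G 1%nat 1 + 15 / 16 * G 1%nat (1 - h / 6) - 21 / 16 * G 1%nat (1 - h / 3)
         + 47 / 48 * G 1%nat (1 - h / 2))
  <= M * (19 / 207360 * h ^ 5).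
Proof.
intros HG Hh Hm.
assert (H := left_end _ h m M (derivative_chain_reflect G HG) Hh).
cbv beta in H; rewrite Rminus_0_r in H.
assert (H' : forall x, 0 <= x <= h / 2 -> m <= (-1) ^ 6 * G 5%nat (1 - x) <= M).
{ intros x Hx; replace ((-1) ^ 6 * G 5%nat (1 - x)) with (G 5%nat (1 - x)) by ring; apply Hm; lra. }
specialize (H H'); simpl ((-1) ^ _) in H; lra.
Qed.

Lemma middle_cells G h m M K : derivative_chain G -> 0 < h -> (1 <= K)%nat ->
  (forall x, h / 2 <= x <= h / 2 + INR K * h -> m <= G 5%nat x <= M) ->
  m * (INR K * (h ^ 5 / 720)) <=
  G O (h / 2 + INR K * h) - G O (h / 2)
  + h ^ 2 / 12 * (G 2%nat (h / 2 + INR K * h) - G 2%nat (h / 2))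
  - h / 2 * (G 1%nat (h / 2) + G 1%nat (h / 2 + INR K * h))
  - h * sum_n_m (fun k => G 1%nat ((2 * INR k - 1) * h / 2)) 2 K
  <= M * (INR K * (h ^ 5 / 720)).
Proof.
intros HG Hh HK; induction HK as [|K HK IH]; intros Hm.
(* For a single cell the sum from 2 to 1 is empty: there is no interior node yet. *)
- assert (H := middle_cell G (h / 2) h m M HG Hh).
  rewrite sum_n_m_zero by lia; simpl INR in *; unfold zero; simpl.
  rewrite !Rmult_1_l in *; specialize (H Hm); lra.
- assert (H := middle_cell G (h / 2 + INR K * h) h m M HG Hh).
  rewrite S_INR in *.
  assert (HK0 := pos_INR K).
  replace (h / 2 + INR K * h + h) with (h / 2 + (INR K + 1) * h) in H by ring.
  assert (IH' := IH ltac:(intros; apply Hm; nra)).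
  assert (H' := H ltac:(intros; apply Hm; nra)).
  rewrite sum_n_Sm by lia; rewrite S_INR.
  replace ((2 * (INR K + 1) - 1) * h / 2) with (h / 2 + INR K * h) by field.
  unfold plus; simpl; lra.
Qed.

(** * Assembly of the cells into the formula *)

Lemma Qn6_eq n f : (3 <= n)%nat ->
  let h := / INR n in
  Qn6 n f =
  h * (- (5 / 48) * f 0 + 15 / 16 * f (h / 6) - 21 / 16 * f (h / 3) + 47 / 48 * f (h / 2))
  + h * (- (5 / 48) * f 1 + 15 / 16 * f (1 - h / 6) - 21 / 16 * f (1 - h / 3) + 47 / 48 * f (1 - h / 2))
  + h / 2 * (f (h / 2) + f (1 - h / 2))
  + h * sum_n_m (fun k => f ((2 * INR k - 1) * h / 2)) 2 (n - 1).
Proof.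
intros Hn h; assert (Hn0 : 0 < INR n) by (apply lt_0_INR; lia).
unfold Qn6, Defs.sigma; rewrite Rminus_0_r.
replace (1 / (6 * INR n)) with (h / 6) by (unfold h; field; lra).
replace (1 / (3 * INR n)) with (h / 3) by (unfold h; field; lra).
replace (1 / (2 * INR n)) with (h / 2) by (unfold h; field; lra).
rewrite (sum_n_m_ext _ (fun k => f ((2 * INR k - 1) * h / 2))).
- unfold h; field; lra.
- intros k; f_equal; unfold h; field; lra.
Qed.

Definition c4_Qn6 (n : nat) : R := 1 / (720 * INR n ^ 4) * (1 - 125 / (144 * INR n)).

Lemma c4_Qn6_pos n : (3 <= n)%nat -> 0 < c4_Qn6 n.
Proof.
intros Hn; assert (Hn0 : 3 <= INR n) by (apply (le_INR 3) in Hn; simpl in Hn; lra).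
unfold c4_Qn6; apply Rmult_lt_0_compat.
- apply Rdiv_lt_0_compat; [lra|]; assert (0 < INR n ^ 4) by (apply pow_lt; lra); lra.
- assert (125 / (144 * INR n) < 1); [|lra].
  apply (Rmult_lt_reg_r (144 * INR n)); [lra|]; unfold Rdiv; rewrite Rmult_assoc, Rinv_l by lra; lra.
Qed.

Lemma Qn6_bounds n G m M : (3 <= n)%nat -> derivative_chain G ->
  (forall x, 0 <= x <= 1 -> m <= G 5%nat x <= M) ->
  c4_Qn6 n * m <= G O 1 - G O 0 - Qn6 n (G 1%nat) <= c4_Qn6 n * M.
Proof.
intros Hn HG Hm; assert (Hn0 : 3 <= INR n) by (apply (le_INR 3) in Hn; simpl in Hn; lra).
set (h := / INR n).
assert (Hh : 0 < h) by (apply Rinv_0_lt_compat; lra).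
assert (Hnh : INR n * h = 1) by (apply Rinv_r; lra).
assert (Hh1 : h <= 1 / 3) by nra.
assert (L := left_end G h m M HG Hh ltac:(intros; apply Hm; lra)).
assert (R := right_end G h m M HG Hh ltac:(intros; apply Hm; lra)).
assert (EK : h / 2 + INR (n - 1) * h = 1 - h / 2).
{ rewrite minus_INR by lia; simpl; lra. }
assert (C := middle_cells G h m M (n - 1) HG Hh ltac:(lia)).
rewrite EK in C.
assert (C' := C ltac:(intros; apply Hm; lra)).
rewrite Qn6_eq by exact Hn; cbv zeta; fold h.
(* The integral of the kernel: n - 1 interior cells and two ends. In units of h^5/720 the ends
   contribute 19/144, whence 1 - 19/144 = 125/144. The terms in [G 2] telescope and cancel against
   the ends. *)
assert (Ec : c4_Qn6 n = INR (n - 1) * (h ^ 5 / 720) + 2 * (19 / 207360 * h ^ 5)).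
{ rewrite minus_INR by lia; unfold c4_Qn6, h; simpl; field; lra. }
rewrite Ec; lra.
Qed.

Lemma Qn6_ext n f g : (3 <= n)%nat -> (forall x, I01 x -> f x = g x) -> Qn6 n f = Qn6 n g.
Proof.
intros Hn H; assert (Hn0 : 3 <= INR n) by (apply (le_INR 3) in Hn; simpl in Hn; lra).
rewrite !Qn6_eq by exact Hn; cbv zeta; set (h := / INR n).
assert (Hh : 0 < h) by (apply Rinv_0_lt_compat; lra).
assert (Hnh : INR n * h = 1) by (apply Rinv_r; lra).
assert (Hh1 : h <= 1 / 3) by nra.
rewrite !H by (unfold I01; lra).
f_equal; f_equal; apply sum_n_m_ext_loc; intros k Hk.
apply H; unfold I01.
assert (K1 : 2 <= INR k) by (apply (le_INR 2); lia).
assert (K2 : INR k + 1 <= INR n) by (rewrite <- S_INR; apply le_INR; lia).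
nra.
Qed.

Lemma Qn6_error_constant n : (3 <= n)%nat -> is_error_constant 4 (Qn6 n) (c4_Qn6 n).
Proof.
intros Hn; assert (Hc := c4_Qn6_pos n Hn); split; [exact Hc|].
intros f d Hd; destruct (extend_C4 f d Hd) as [G [HG [E1 E5]]].
assert (HR : remainder (Qn6 n) f = G O 1 - G O 0 - Qn6 n (G 1%nat)).
{ unfold remainder; rewrite (Qn6_ext n f (G 1%nat)) by (auto; intros; symmetry; auto).
  f_equal.
  rewrite (RInt_ext f (G 1%nat)).
  - apply RInt_of_derive; intros x; [apply (proj1 HG); lia|].
    apply (ex_derive_continuous (G 1%nat)); eexists; apply (proj1 HG); lia.
  - rewrite Rmin_left, Rmax_right by lra; intros x Hx; symmetry; apply E1; unfold I01; lra. }
assert (Hcont : forall x, continuity_pt (G 5%nat) x).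
{ intros x; apply continuity_pt_filterlim, (proj2 HG). }
destruct (continuity_ab_min (G 5%nat) 0 1 ltac:(lra) (fun x _ => Hcont x)) as [xm [Hm1 Hm2]].
destruct (continuity_ab_maj (G 5%nat) 0 1 ltac:(lra) (fun x _ => Hcont x)) as [xM [HM1 HM2]].
assert (B := Qn6_bounds n G (G 5%nat xm) (G 5%nat xM) Hn HG ltac:(intros; split; auto)).
rewrite <- HR in B; set (R := remainder (Qn6 n) f) in *.
destruct (IVT_gen (G 5%nat) xm xM (R / c4_Qn6 n)) as [xi [X1 X2]].
- intros x; apply Hcont.
- assert (Hle := HM1 xm Hm2).
  rewrite Rmin_left, Rmax_right by exact Hle.
  split; apply (Rmult_le_reg_l (c4_Qn6 n)); try exact Hc;
    replace (c4_Qn6 n * (R / c4_Qn6 n)) with R by (field; lra); lra.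
- assert (Hxi : 0 <= xi <= 1).
  { unfold Rmin, Rmax in X1; destruct (Rle_dec xm xM); lra. }
  exists xi; split; [exact Hxi|].
  rewrite <- (E5 xi Hxi), X2; field; lra.
Qed.

Ltac decide_leb := repeat match goal with
  |- context [Nat.leb ?i ?j] => destruct (Nat.leb_spec i j); try (exfalso; lia) end.

Lemma Qn6_is_quadrature n : (3 <= n)%nat -> is_quadrature (n + 6) (Qn6 n).
Proof.
intros Hn; assert (Hn0 : 3 <= INR n) by (apply (le_INR 3) in Hn; simpl in Hn; lra).
set (h := / INR n).
assert (Hh : 0 < h) by (apply Rinv_0_lt_compat; lra).
assert (Hnh : INR n * h = 1) by (apply Rinv_r; lra).
assert (Hh1 : h <= 1 / 3) by nra.
(* Three nodes precede h/2, so the index i = k + 3 carries the midpoint (2k - 1) h / 2 for k = 1,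
   ..., n. *)
pose (tau := fun i => if (i <=? 1)%nat then 0 else if (i <=? 2)%nat then h / 6
  else if (i <=? 3)%nat then h / 3 else if (i <=? n + 3)%nat then (2 * INR i - 7) * h / 2
  else if (i <=? n + 4)%nat then 1 - h / 3 else if (i <=? n + 5)%nat then 1 - h / 6 else 1).
pose (a := fun i => if (i <=? 1)%nat then - (5 / 48) * h else if (i <=? 2)%nat then 15 / 16 * h
  else if (i <=? 3)%nat then - (21 / 16) * h else if (i <=? 4)%nat then 71 / 48 * h
  else if (i <=? n + 2)%nat then h else if (i <=? n + 3)%nat then 71 / 48 * h
  else if (i <=? n + 4)%nat then - (21 / 16) * h else if (i <=? n + 5)%nat then 15 / 16 * h
  else - (5 / 48) * h).
assert (Hmid : forall i, (4 <= i <= n + 3)%nat -> 4 * h <= INR i * h <= 1 + 3 * h).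
{ intros i Hi; assert (I1 : 4 <= INR i) by (replace 4 with (INR 4) by (simpl; ring); apply le_INR; lia).
  assert (I2 : INR i <= INR n + 3).
  { replace 3 with (INR 3) by (simpl; ring); rewrite <- plus_INR; apply le_INR; lia. }
  nra. }
exists a, tau; split; [|split].
- intros i Hi; unfold tau.
  decide_leb; try lra; assert (X := Hmid i ltac:(lia)); lra.
- intros i Hi; unfold tau.
  decide_leb; try lra; try (assert (X := Hmid (S i) ltac:(lia))); try (assert (Y := Hmid i ltac:(lia)));
  rewrite ?S_INR in *; try nra.
- intros f; rewrite Qn6_eq by exact Hn; cbv zeta; fold h.
  set (Sg := sum_n_m (fun k => f ((2 * INR k - 1) * h / 2)) 2 (n - 1)).
  replace (n + 6)%nat with (S (S (S (S (n + 2))))) by lia.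
  rewrite !(sum_n_Sm _ 1) by lia.
  rewrite (sum_Sn_m _ 1), (sum_Sn_m _ 2), (sum_Sn_m _ 3), (sum_Sn_m _ 4) by lia.
  replace (n + 2)%nat with (S (S (S (n - 1)))) by lia.
  rewrite <- (sum_n_m_S _ 4), <- (sum_n_m_S _ 3), <- (sum_n_m_S _ 2).
  assert (Em : sum_n_m (fun k => a (S (S (S k))) * f (tau (S (S (S k))))) 2 (n - 1) =
     h * Sg).
  { unfold Sg; change Rmult with (mult (K := R_Ring)).
    rewrite <- (sum_n_m_mult_l (K := R_Ring)).
    apply sum_n_m_ext_loc; intros k Hk; unfold mult; simpl.
    unfold a, tau.
    decide_leb; rewrite !S_INR; f_equal; f_equal; field. }
  rewrite Em; clear Em.
  replace (S (S (S (n - 1)))) with (n + 2)%nat by lia.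
  replace (S (n + 2)) with (n + 3)%nat by lia.
  replace (S (n + 3)) with (n + 4)%nat by lia.
  replace (S (n + 4)) with (n + 5)%nat by lia.
  replace (S (n + 5)) with (n + 6)%nat by lia.
  assert (T1 : a 1%nat * f (tau 1%nat) = - (5 / 48) * h * f 0) by reflexivity.
  assert (T2 : a 2%nat * f (tau 2%nat) = 15 / 16 * h * f (h / 6)) by reflexivity.
  assert (T3 : a 3%nat * f (tau 3%nat) = - (21 / 16) * h * f (h / 3)) by reflexivity.
  assert (T4 : a 4%nat * f (tau 4%nat) = 71 / 48 * h * f (h / 2)).
  { unfold a, tau; decide_leb.
    f_equal; f_equal; simpl; field. }
  assert (T5 : a (n + 3)%nat * f (tau (n + 3)%nat) = 71 / 48 * h * f (1 - h / 2)).
  { unfold a, tau; decide_leb.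
    f_equal; f_equal; rewrite plus_INR; simpl; lra. }
  assert (T6 : a (n + 4)%nat * f (tau (n + 4)%nat) = - (21 / 16) * h * f (1 - h / 3)).
  { unfold a, tau; decide_leb; reflexivity. }
  assert (T7 : a (n + 5)%nat * f (tau (n + 5)%nat) = 15 / 16 * h * f (1 - h / 6)).
  { unfold a, tau; decide_leb; reflexivity. }
  assert (T8 : a (n + 6)%nat * f (tau (n + 6)%nat) = - (5 / 48) * h * f 1).
  { unfold a, tau; decide_leb; reflexivity. }
  rewrite T1, T2, T3, T4, T5, T6, T7, T8.
  unfold plus; simpl; field.
Qed.

(** * Asymptotic optimality *)

Lemma c_plus_bounds n : (3 <= n)%nat ->
  1 / (720 * INR (n + 12) ^ 4) <= c_plus (n + 6) 4 <= c4_Qn6 n.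
Proof.
intros Hn; unfold c_plus.
set (S := fun c => exists Q, is_quadrature (n + 6) Q /\ positive_definite 4 Q /\ c = error_constant 4 Q).
destruct (Glb_Rbar_correct S) as [Hlb Hglb].
assert (Hin : S (c4_Qn6 n)).
{ exists (Qn6 n); split; [apply Qn6_is_quadrature, Hn|].
  assert (H := Qn6_error_constant n Hn).
  split; [exists (c4_Qn6 n); exact H | symmetry; apply error_constant_eq, H]. }
assert (Hlow : forall c, S c -> 1 / (720 * INR (n + 12) ^ 4) <= c).
{ intros c [Q [HQ [[c' Hc'] ->]]].
  rewrite (error_constant_eq Q c' Hc').
  destruct (quadrature_list _ _ HQ) as [A [HlA [HA HQA]]].
  assert (HcA : is_error_constant 4 (lin A) c').
  { destruct Hc' as [H0 H1]; split; [exact H0|]; intros f d Hd.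
    unfold remainder; rewrite <- HQA; apply H1, Hd. }
  assert (H := error_constant_ge A c' HA HcA).
  replace (length A + 6)%nat with (n + 12)%nat in H by lia; exact H. }
assert (H1 := Hlb _ Hin).
assert (H2 := Hglb (Finite (1 / (720 * INR (n + 12) ^ 4))) (fun c Hc => Hlow c Hc)).
(* [real] sends infinities to 0, so both must be excluded: the formula itself rules out the upper
   one, the lower bound the other. *)
destruct (Glb_Rbar S); simpl in *; [lra | contradiction | contradiction].
Qed.

Lemma is_lim_seq_ratio : is_lim_seq (fun n => (1 + 12 * / INR n) ^ 4) 1.
Proof.
assert (H : is_lim_seq (fun n => / INR n) 0).
{ apply (is_lim_seq_inv INR p_infty is_lim_seq_INR); discriminate. }
assert (H1 : is_lim_seq (fun n => 1 + 12 * / INR n) 1).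
{ replace (Finite 1) with (Finite (1 + 12 * 0)) by (f_equal; ring).
  apply is_lim_seq_plus'; [apply is_lim_seq_const|].
  apply (is_lim_seq_scal_l (fun n => / INR n) 12 0 H). }
replace (Finite 1) with (Finite (1 * (1 * (1 * (1 * 1))))) by (f_equal; ring).
simpl pow.
repeat (apply is_lim_seq_mult'; [exact H1|]); apply is_lim_seq_const.
Qed.

Theorem mainTheorem13 :
  (forall n : nat, (3 <= n)%nat ->
     is_quadrature (n + 6) (Qn6 n) /\
     positive_definite 4 (Qn6 n) /\
     error_constant 4 (Qn6 n)
       = 1 / (720 * INR n ^ 4) * (1 - 125 / (144 * INR n))) /\
  is_lim_seq (fun n : nat => error_constant 4 (Qn6 n) / c_plus (n + 6) 4) 1.
Proof.
split.
- intros n Hn; split; [apply Qn6_is_quadrature, Hn|].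
  assert (H := Qn6_error_constant n Hn).
  split; [exists (c4_Qn6 n); exact H | apply error_constant_eq, H].
(* In the upper bound, 12 is the sum of the 6 additional nodes and the 6 lost in
   [error_constant_ge]. *)
- apply (is_lim_seq_le_le_loc (fun _ => 1) _ (fun n => (1 + 12 * / INR n) ^ 4));
    [|apply is_lim_seq_const | apply is_lim_seq_ratio].
  exists 3%nat; intros n Hn.
  assert (Hn0 : 3 <= INR n) by (apply (le_INR 3) in Hn; simpl in Hn; lra).
  rewrite (error_constant_eq _ _ (Qn6_error_constant n Hn)).
  destruct (c_plus_bounds n Hn) as [H1 H2].
  assert (Hc := c4_Qn6_pos n Hn).
  rewrite plus_INR in H1; simpl (INR 12) in H1.
  set (L := 1 / (720 * _)) in H1.
  assert (HL : 0 < L).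
  { unfold L; apply Rdiv_lt_0_compat; [lra|].
    apply Rmult_lt_0_compat; [lra | apply pow_lt; lra]. }
  set (cp := c_plus (n + 6) 4) in *.
  assert (Hc2 : c4_Qn6 n <= L * (1 + 12 * / INR n) ^ 4).
  { replace (L * (1 + 12 * / INR n) ^ 4) with (1 / (720 * INR n ^ 4)) by (unfold L; field; lra).
    unfold c4_Qn6; rewrite <- (Rmult_1_r (1 / (720 * INR n ^ 4))) at 2.
    apply Rmult_le_compat_l.
    - left; apply Rdiv_lt_0_compat; [lra|].
      apply Rmult_lt_0_compat; [lra | apply pow_lt; lra].
    - assert (0 < 125 / (144 * INR n)) by (apply Rdiv_lt_0_compat; lra); lra. }
  assert (Hp : 0 < (1 + 12 * / INR n) ^ 4).
  { apply pow_lt; assert (0 < / INR n) by (apply Rinv_0_lt_compat; lra); lra. }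
  split; apply (Rmult_le_reg_r cp); try lra;
    unfold Rdiv; rewrite Rmult_assoc, Rinv_l, Rmult_1_r by lra; nra.
Qed.
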